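(* Consider the triangular simultaneous equations model and fitted regressor matrix $\hat X$ described in the context, and let $r\in[0,1]$. Assume: (i) the data $\{y_i,\mathbf{x}_i,\mathbf{z}_i\}_{i=1}^n$ are i.i.d. with finite second moments, $\mathbb{E}(\mathbf{z}_{ij}\epsilon_i)=\mathbb{E}(\mathbf{z}_{ij}\eta_{ij})=\mathbf{0}$ for all $j=1,\dots,p$, and $\mathbb{E}(\mathbf{z}_{ij}\eta_{ij'})=\mathbf{0}$ for all $j\neq j'$; (ii) $p$ and $d$ can grow with and exceed $n$; each $\pi_j^*$ has at most $k_1$ non-zero components and $\beta^*$ has at most $k_2$ non-zero components, where $k_1,k_2$ can increase to infinity with $n$ but slowly compared to $n$; (iii) $\epsilon$ and $\eta_j$ ($j=1,\dots,p$) are i.i.d. zero-mean sub-Gaussian vectors with parameters $\sigma_\epsilon^2$ and $\sigma_\eta^2$ respectively, and $Z_j$ is a sub-Gaussian matrix with parameters $(\Sigma_{Z_j},\sigma_Z^2)$ for each $j$; (iv) $X^*$ is a sub-Gaussian matrix with parameters $(\Sigma_{X^*},\sigma_{X^*}^2)$; (v) for $v_j\in\mathbb{K}(k_1,d_j)$, $j=1,\dots,p$, the matrix $W\in\mathbb{R}^{n\times p}$ with $j$th column $Z_jv_j$ is sub-Gaussian with parameters $(\Sigma_W,\sigma_W^2)$; (vi) the first-stage estimator satisfies $\max_{j}|\hat\pi_j-\pi_j^*|_2\le \frac{c\sigma_\eta}{\lambda_{\min}(\Sigma_Z)}\sqrt{\frac{k_1\log\max(d,p)}{n}}$ with probability at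 least $1-c_1\exp(-c_2\log\max(d,p,n))$ for some universal constants $c,c_1,c_2$; (vii) with probability at least $1-c_1\exp(-c_2\log\max(d,p,n))$ for some universal constants $c_1,c_2$, $J(\hat\pi_j)=J(\pi_j^* )$ for every $j=1,\dots,p$; (viii) $n\succsim k_1^{3-2r}\log\max(p,d)$. Then, for some universal constants $c,c',c_1,c_2$, with probability at least $1-c_1\exp(-c_2\log\max(p,d))$, $$\frac{|\hat Xv^0|_2^2}{n}\ge\left(\kappa_1-c\,\kappa_2k_1^{3/2-r}\sqrt{\frac{\log\max(p,d)}{n}}\right)|v^0|_2^2-c'\kappa_3\frac{k_1^r\log\max(p,d)}{n}|v^0|_1^2\qquad\text{for all }v^0\in\mathbb{R}^p,$$ where $\kappa_1=\frac{\lambda_{\min}(\Sigma_{X^*})}{2}$, $\kappa_2=\max(b_2b_1^{-1},b_3b_1^{-2})$, $\kappa_3=\max\{b_0,b_2b_1^{-1},b_3b_1^{-2}\}$, $$b_0=\lambda_{\min}(\Sigma_{X^*})\max\left\{\frac{\sigma_{X^*}^4}{\lambda_{\min}^2(\Sigma_{X^*})},1\right\},\qquad b_1=\frac{\lambda_{\min}(\Sigma_Z)}{\sigma_\eta},$$ $$b_2=\max\left\{\sigma_{X^*}\sigma_W,\ \sup\left|v^{0T}\left[\mathbb{E}(x^*_{1j'}\mathbf{z}_{1j}^Tv^j)\right]_{j',j}v^0\right|\right\},$$ the supremum being over $(v^0,v^1,\dots,v^p)\in\mathbb{K}(2s,p)\times\mathbb{K}(k_1,d_1)\times\cdots\times\mathbb{K}(k_1,d_p)$,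 and $$b_3=\max\left\{\sigma_W^2,\ \sup\left|v^{0T}\left[\mathbb{E}(u^{j'T}\mathbf{z}_{1j'}\mathbf{z}_{1j}^Tv^j)\right]_{j',j}v^0\right|\right\},$$ the supremum being over $v^0\in\mathbb{K}(2s,p)$ and $(u^j,v^j)\in\mathbb{K}^2(k_1,d_j)$, $j=1,\dots,p$.
   Context: Notation: $|v|_q$ is the $l_q$ norm of a vector; $|v|_0$ is the number of non-zero entries; $J(v)=\{j:v_j\ne0\}$. $\mathbb{K}(s,m)=\{v\in\mathbb{R}^m:|v|_0\le s,\ |v|_2\le1\}$ and $\mathbb{K}^2(s,m)=\mathbb{K}(s,m)\times\mathbb{K}(s,m)$. $[A_{j'j}]_{j',j}$ denotes the $p\times p$ matrix with $(j',j)$ entry $A_{j'j}$. $\lambda_{\min}$ is the minimum eigenvalue. $f\succsim g$ means $f\ge cg$ for a universal constant $c\in(0,\infty)$. The sparsity level $s$ is $s=s(r)=\frac1{c_0}\frac{n}{k_1^r\log\max(p,d)}\min\left\{\frac{\lambda_{\min}^2(\Sigma_{X^*})}{\sigma_{X^*}^4},1\right\}$, with $c_0>0$ a universal constant chosen sufficiently small that $s\ge1$. Sub-Gaussian: a random variable $U$ with mean $\mu$ is sub-Gaussian with parameter $\sigma^2$ if $\mathbb{E}[\exp(t(U-\mu))]\le\exp(\sigma^2t^2/2)$ for all $t\in\mathbb{R}$. A random matrix $A\in\mathbb{R}^{n\times m}$ is sub-Gaussian with parameters $(\Sigma_A,\sigma_A^2)$ if its rows are sampled independently from a zero-mean distribution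 on $\mathbb{R}^m$ with covariance $\Sigma_A$ and, for any unit vector $u\in\mathbb{R}^m$, the inner product of $u$ with each row is sub-Gaussian with parameter at most $\sigma_A^2$. Model: for $i=1,\dots,n$, $y_i=\mathbf{x}_i^T\beta^*+\epsilon_i$ with $\mathbf{x}_i,\beta^*\in\mathbb{R}^p$, and $x_{ij}=\mathbf{z}_{ij}^T\pi_j^*+\eta_{ij}$ for $j=1,\dots,p$ with $\mathbf{z}_{ij},\pi_j^*\in\mathbb{R}^{d_j}$; $\epsilon_i,\eta_{ij}$ are zero-mean errors; $\mathbf{z}_i$ collects $\mathbf{z}_{i1},\dots,\mathbf{z}_{ip}$. Stack: $\epsilon\in\mathbb{R}^n$; $\eta_j=(\eta_{1j},\dots,\eta_{nj})^T$; $Z_j\in\mathbb{R}^{n\times d_j}$ has rows $\mathbf{z}_{ij}^T$. $X^*\in\mathbb{R}^{n\times p}$ has $j$th column $Z_j\pi_j^*$ and entries $x^*_{ij}$. Given first-stage estimates $\hat\pi_j$ of $\pi_j^*$, $\hat X\in\mathbb{R}^{n\times p}$ has columns $\hat{\mathbf{x}}_j=Z_j\hat\pi_j$. $\lambda_{\min}(\Sigma_Z)=\min_j\lambda_{\min}(\Sigma_{Z_j})$. Standing conventions: $(y_i,\mathbf{x}_i,\mathbf{z}_i)$ have mean zero; $d_j=d$ for all $j$; $p\ge n$ and $d\ge n$. *)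

(* Defs.v *)
From HB Require Import structures.
From mathcomp Require Import all_boot all_order all_algebra.
From mathcomp Require Import all_classical all_reals all_analysis.

Set Implicit Arguments.
Unset Strict Implicit.
Unset Printing Implicit Defensive.

Import Order.TTheory GRing.Theory Num.Theory.
Import numFieldNormedType.Exports.

Local Open Scope classical_set_scope.
Local Open Scope ring_scope.

Definition l1norm (R : realType) (m : nat) (v : 'cV[R]_m) : R :=
  \sum_(i < m) `|v i 0|.

Definition l2norm (R : realType) (m : nat) (v : 'cV[R]_m) : R :=
  Num.sqrt (\sum_(i < m) v i 0 ^+ 2).

Definition supp (R : realType) (m : nat) (v : 'cV[R]_m) : {set 'I_m} :=
  [set i | v i 0 != 0]%SET.

Definition l0norm (R : realType) (m : nat) (v : 'cV[R]_m) : nat := #|supp v|.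

(* The sparsity level is real-valued: it is used with 2s where s need not be
   an integer. *)
Definition sparse_ball (R : realType) (s : R) (m : nat) : set 'cV[R]_m :=
  [set v | (l0norm v)%:R <= s /\ l2norm v <= 1].

Definition quad_form (R : realType) (m : nat) (A : 'M[R]_m) (v : 'cV[R]_m) : R :=
  (v^T *m A *m v) 0 0.

Definition lambda_min (R : realType) (m : nat) (A : 'M[R]_m) : R :=
  inf [set a : R | eigenvalue A a].

Definition mean d (T : measurableType d) (R : realType) (P : probability T R)
  (U : T -> R) : R := fine 'E_P[U]%E.

Definition zero_mean d (T : measurableType d) (R : realType)
    (P : probability T R) (U : T -> R) : Prop :=
  U \in Lfun P 1%E /\ ('E_P[U] = 0)%E.

(* Taking B i = setT for some of the indices gives the product rule for every
   subfamily. *)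
Definition mutually_independent d d' (T : measurableType d)
    (T' : measurableType d') (R : realType) (P : probability T R)
    (n : nat) (X : 'I_n -> T -> T') : Prop :=
  forall B : 'I_n -> set T', (forall i, measurable (B i)) ->
  (P (\bigcap_(i in [set: 'I_n]) (X i @^-1` B i)) =
   \prod_(i < n) P (X i @^-1` B i))%E.

Definition identically_distributed d d' (T : measurableType d)
    (T' : measurableType d') (R : realType) (P : probability T R)
    (n : nat) (X : 'I_n -> T -> T') : Prop :=
  forall (i j : 'I_n) (B : set T'), measurable B ->
  P (X i @^-1` B) = P (X j @^-1` B).

Definition iid d d' (T : measurableType d) (T' : measurableType d')
    (R : realType) (P : probability T R) (n : nat) (X : 'I_n -> T -> T') : Prop :=
  [/\ forall i, measurable_fun [set: T] (X i),
      mutually_independent P X & identically_distributed P X].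

Definition sub_gaussian d (T : measurableType d) (R : realType)
    (P : probability T R) (U : T -> R) (sigma2 : R) : Prop :=
  U \in Lfun P 1%E /\
  forall t : R, ('E_P[fun w => expR (t * (U w - mean P U))] <=
                 (expR (sigma2 * t ^+ 2 / 2))%:E)%E.

(* Vectors of R^m as elements of the measurable type m.-tuple R, since the
   library does not equip matrices with a sigma-algebra. *)
Definition row_tuple (R : realType) (n m : nat) (A : 'M[R]_(n, m)) (i : 'I_n) :
  m.-tuple R := [tuple A i j | j < m].

Definition sub_gaussian_mx d (T : measurableType d) (R : realType)
    (P : probability T R) (n m : nat) (A : T -> 'M[R]_(n, m))
    (Sigma : 'M[R]_m) (sigma2 : R) : Prop :=
  [/\ iid P (fun i w => row_tuple (A w) i),
      forall i j, zero_mean P (fun w => A w i j),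
      forall i j j', covariance P (fun w => A w i j) (fun w => A w i j') =
                     (Sigma j j')%:E
    & forall (u : 'cV[R]_m) (i : 'I_n), l2norm u = 1 ->
        sub_gaussian P (fun w => (A w *m u) i 0) sigma2].

Definition sub_gaussian_vec d (T : measurableType d) (R : realType)
    (P : probability T R) (n : nat) (e : T -> 'cV[R]_n) (sigma2 : R) : Prop :=
  [/\ iid P (fun i w => e w i 0),
      forall i, zero_mean P (fun w => e w i 0)
    & forall i, sub_gaussian P (fun w => e w i 0) sigma2].

(* The matrix with j-th column Z_j v_j. *)
Definition stage_mx (R : realType) (n p d : nat) (Z : 'I_p -> 'M[R]_(n, d))
    (v : 'I_p -> 'cV[R]_d) : 'M[R]_(n, p) :=
  \matrix_(i, j) (Z j *m v j) i 0.

Definition data_row (R : realType) (n p d : nat) (y : 'cV[R]_n)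
    (X : 'M[R]_(n, p)) (Z : 'I_p -> 'M[R]_(n, d)) (i : 'I_n) :
    R * p.-tuple R * p.-tuple (d.-tuple R) :=
  (y i 0, row_tuple X i, [tuple row_tuple (Z j) i | j < p]).

(* [E (a_{i j'} b_{i j})]_{j', j}: the expected outer product of the i-th rows
   of two random matrices A and B; with A = stage_mx Z u and B = stage_mx Z v
   its (j', j) entry is E(u^{j'T} z_{ij'} z_{ij}^T v^j). *)
Definition cross_moment d (T : measurableType d) (R : realType)
    (P : probability T R) (n p : nat) (A B : T -> 'M[R]_(n, p)) (i : 'I_n) :
    'M[R]_p :=
  \matrix_(j', j) mean P (fun w => A w i j' * B w i j).

Definition sup_b2 d (T : measurableType d) (R : realType) (P : probability T R)
    (n p q : nat) (Z : 'I_p -> T -> 'M[R]_(n, q)) (pistar : 'I_p -> 'cV[R]_q)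
    (k : nat) (s : R) (i : 'I_n) : R :=
  sup [set x | exists (v0 : 'cV[R]_p) (v : 'I_p -> 'cV[R]_q),
    [/\ sparse_ball (2 * s) v0,
        forall j, sparse_ball k%:R (v j)
      & x = `|quad_form
                (cross_moment P (fun w => stage_mx (Z ^~ w) pistar)
                                (fun w => stage_mx (Z ^~ w) v) i) v0| ]].

Definition sup_b3 d (T : measurableType d) (R : realType) (P : probability T R)
    (n p q : nat) (Z : 'I_p -> T -> 'M[R]_(n, q)) (k : nat) (s : R) (i : 'I_n) : R :=
  sup [set x | exists (v0 : 'cV[R]_p) (u v : 'I_p -> 'cV[R]_q),
    [/\ sparse_ball (2 * s) v0,
        forall j, sparse_ball k%:R (u j) /\ sparse_ball k%:R (v j)
      & x = `|quad_form
                (cross_moment P (fun w => stage_mx (Z ^~ w) u)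
                                (fun w => stage_mx (Z ^~ w) v) i) v0| ]].

(* Main.v *)
Require Import Defs.
From mathcomp Require Import all_boot all_order all_algebra.
From mathcomp Require Import all_classical all_reals all_analysis.
From mathcomp Require Import finmap measurable_realfun ring lra.

Set Implicit Arguments.
Unset Strict Implicit.
Unset Printing Implicit Defensive.

Import Order.TTheory GRing.Theory Num.Theory.
Import numFieldNormedType.Exports.

Local Open Scope classical_set_scope.
Local Open Scope ring_scope.

(** Let L = ln (max p d), let Xs be the matrix with columns Z_j pi_j, and let
    D_j be the error of the first-stage estimate of pi_j. The two first-stage
    hypotheses give an event on which every D_j is k1-sparse with norm at most
    delta = cA (sigma_eta / lamZ) sqrt (k1 L / n). With Z U = sum_j Z_j U_j for
    a matrix U of columns U_j, and U the matrix of columns v_j D_j,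

      |Xhat v|^2 >= |Xs v|^2 - 2 |Xs v| |Z U|,

    so it is enough to know, for all directions at once and up to constants,
      - |Xs v|^2 / n >= (lamX / 2) |v|^2 - b0 (L / n) |v|_1^2,
      - |Xs v|^2 / n <= sigma_X^2 (|v|^2 + (L / n) |v|_1^2),
      - |Z U|^2 / n <= sigma_W^2 (|U|^2 + (L / n) |U|_1^2) for matrices U with
        k1-sparse columns.
    As |U|^2 <= delta^2 |v|^2 and |U|_1^2 <= k1 delta^2 |v|_1^2, the cross term is
    at most a constant times
    sigma_X sigma_W delta (|v|^2 + k1 (L / n) |v|_1^2); since
    sigma_X sigma_W <= b2 this is absorbed by kappa2 and kappa3, the lower bound
    on n turning k1^(3/2) sqrt (L / n) into a multiple of k1^r.

    Each of the three estimates says that a quadratic form G satisfies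
    G(U) <= const |U|_1^2 / m, and is obtained by Maurey's empirical method
    (maurey_quadratic_le): U / |U|_1 is the mean of a random signed basis
    vector, and the expectation of G at a sum of m independent copies is an
    explicit combination of G(U) and of the values of G at basis vectors. Hence
    only the (2pd)^m sums of m signed basis vectors have to be controlled, which
    is a union bound; this replaces a net of a sparse ball. The number m is of
    order n / L for the upper bounds and n rho^2 / L for the lower one, with
    rho = min (lamX / sigma_X^2) 1 (uniform_upper_bound, uniform_lower_bound).

    In a single direction the squares of the coordinates have exponential
    moments (sub_gaussian_expR_sqr, centered_mgf_le), independence of the rows
    makes the exponential moments multiply (independent_integral_prod), and
    Chernoff's bound concludes. The population form is bounded below by the
    smallest eigenvalue (lambda_min_quad).

    If n rho^2 / L is too small for some m >= 2 to exist, the right-hand side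
    of the conclusion is nonpositive (vacuous_lower_bound). Finally the event of
    the theorem quantifies over uncountably many directions; it is measurable
    because rational directions are dense (measurable_quadratic_event). *)

(** * Optimizing quadratic forms over sums of few signed basis vectors *)

Lemma le_of_eq (R : realFieldType) (x y : R) : x = y -> x <= y.
Proof. by move=> ->. Qed.

Lemma weighted_mean_le (R : realFieldType) (I : finType) (q h : I -> R) :
  (forall i, 0 <= q i) -> \sum_i q i = 1 ->
  exists2 i, 0 < q i & \sum_i q i * h i <= h i.
Proof.
move=> q0 q1; set c := \sum_i _.
have [i /andP[]|H] := pickP (fun i => (0 < q i) && (c <= h i)); first by exists i.
have H' i : q i * (h i - c) <= 0.
  have := q0 i; rewrite le_eqVlt => /predU1P[<-|qi]; first by rewrite mul0r.
  by have := H i; rewrite qi /= pmulr_rle0// subr_le0 => /negbT; rewrite -ltNge => /ltW.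
have S0 : \sum_i - (q i * (h i - c)) = 0.
  rewrite sumrN (eq_bigr (fun i => q i * h i - q i * c)); last by move=> i _; rewrite mulrBr.
  by rewrite sumrB -mulr_suml q1 mul1r subrr oppr0.
have Z i : q i * (h i - c) = 0.
  apply/eqP; rewrite -oppr_eq0; move/eqP: S0; rewrite psumr_eq0.
    by move=> /allP/(_ i (mem_index_enum _)).
  by move=> j _; rewrite oppr_ge0.
have [j qj] : exists j, 0 < q j.
  apply: contrapT => nj; have : \sum_i q i = 0.
    apply: big1 => i _; apply/eqP; rewrite eq_le q0 andbT leNgt.
    by apply/negP => qi; apply: nj; exists i.
  by rewrite q1; apply/eqP; rewrite oner_eq0.
exists j => //; move/eqP: (Z j); rewrite mulf_eq0 gt_eqF//= subr_eq0 => /eqP ->//.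
Qed.

(** The right-hand side of the inequality is the expectation of the quadratic
    form at a plus m independent draws of e, where e i has probability q i; some
    outcome does at least as well. Fixing the draws one at a time, each no worse
    than its conditional mean, avoids the product distribution; the starting
    point a is there for this induction. *)
Lemma maurey_sampling (R : realFieldType) (V : lmodType R) (B : V -> V -> R)
    (I : finType) (q : I -> R) (e : I -> V) :
  (forall u v, B u v = B v u) ->
  (forall a u v w, B (a *: u + v) w = a * B u w + B v w) ->
  (forall i, 0 <= q i) -> \sum_i q i = 1 ->
  let u := \sum_i q i *: e i in
  forall (m : nat) (a : V), exists l : seq I,
  [/\ size l = m, all (fun i => 0 < q i) l &
    B a a + 2 * m%:R * B a u + m%:R * (m%:R - 1) * B u u
      + m%:R * \sum_i q i * B (e i) (e i)
    <= B (a + \sum_(i <- l) e i) (a + \sum_(i <- l) e i)].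
Proof.
move=> Bsym Blin q0 q1 u.
have BD x y w : B (x + y) w = B x w + B y w by rewrite -[x]scale1r Blin mul1r scale1r.
have B0 w : B 0 w = 0 by apply: (addrI (B 0 w)); rewrite -BD !addr0.
have BZ c x w : B (c *: x) w = c * B x w by rewrite -[c *: x]addr0 Blin B0 addr0.
have Bu w : B u w = \sum_i q i * B (e i) w.
  rewrite /u (big_morph (fun x => B x w) (fun x y => BD x y w) (B0 w)).
  by apply: eq_bigr => i _; rewrite BZ.
elim=> [|m IH] a.
  by exists [::]; split => //; rewrite big_nil !addr0 !mulr0 !mul0r !addr0.
pose f (x : V) := B x x + 2 * m%:R * B x u + m%:R * (m%:R - 1) * B u u
  + m%:R * \sum_i q i * B (e i) (e i).
have [i qi hi] := weighted_mean_le (fun i => f (a + e i)) q0 q1.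
have [l [sl al hl]] := IH (a + e i).
exists (i :: l); split => /=; [by rewrite sl | by rewrite qi | ].
rewrite big_cons addrA; apply: le_trans hl; apply: le_trans hi.
set E := \sum_i q i * B (e i) (e i).
pose c := B a a + 2 * m%:R * B a u + m%:R * (m%:R - 1) * B u u + m%:R * E.
have fE j : q j * f (a + e j) = q j * c + (2 * (q j * B (e j) a) +
    (q j * B (e j) (e j) + 2 * m%:R * (q j * B (e j) u))).
  rewrite /f /c !BD !(Bsym _ (a + e j)) !BD !(Bsym a (e j)) -/E; ring.
have -> : \sum_i q i * f (a + e i) = c + (2 * B u a + (E + 2 * m%:R * B u u)).
  rewrite (eq_bigr _ (fun j _ => fE j)) !big_split /= -!mulr_sumr -!Bu -/E.
  by rewrite -mulr_suml q1 mul1r.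
rewrite (Bsym u a) /c -natr1; apply: le_of_eq; ring.
Qed.

(** The test matrices of Maurey's method: sums of signed elementary matrices,
    the boolean being the sign. *)
Definition atom_sum (R : pzRingType) (p q : nat) (t : seq ('I_p * 'I_q * bool)) : 'M[R]_(p, q) :=
  \sum_(x <- t) (-1) ^+ x.2 *: delta_mx x.1.1 x.1.2.

Definition l1mx (R : numDomainType) (p q : nat) (U : 'M[R]_(p, q)) : R :=
  \sum_i \sum_j `|U i j|.

Definition mdot (R : pzRingType) (p q : nat) (U V : 'M[R]_(p, q)) : R :=
  \sum_i \sum_j U i j * V i j.

(** The sampling bound applied to U / l1mx U, the mean of signed elementary
    matrices drawn with probabilities proportional to the entries of U. The
    m (m - 1) off-diagonal pairs contribute B U U and the m diagonal ones at
    least - m b, whence the loss of order b / m. The signs are those of U, so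
    every outcome is supported where U is, which preserves sparsity. *)
Lemma maurey_quadratic_le (R : realFieldType) (p q m : nat)
    (B : 'M[R]_(p, q) -> 'M[R]_(p, q) -> R) (b : R) (U : 'M[R]_(p, q)) :
  (forall u v, B u v = B v u) ->
  (forall a u v w, B (a *: u + v) w = a * B u w + B v w) ->
  0 <= b -> (1 < m)%N ->
  (forall t : m.-tuple ('I_p * 'I_q * bool),
     (forall x, x \in tval t -> U x.1.1 x.1.2 != 0) ->
     B (atom_sum R t) (atom_sum R t) <= 0) ->
  (forall i j, - b <= B (delta_mx i j) (delta_mx i j)) ->
  B U U <= 2 * b / m%:R * l1mx U ^+ 2.
Proof.
move=> Bsym Blin b0 m1 HB Hb.
have BD x y w : B (x + y) w = B x w + B y w by rewrite -[x]scale1r Blin mul1r scale1r.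
have B0 w : B 0 w = 0 by apply: (addrI (B 0 w)); rewrite -BD !addr0.
have BZ c x w : B (c *: x) w = c * B x w by rewrite -[c *: x]addr0 Blin B0 addr0.
have m0 : (0 : R) < m%:R by rewrite ltr0n; case: m m1 HB.
set s := l1mx U.
have s0 : 0 <= s by apply: sumr_ge0 => i _; apply: sumr_ge0.
have rhs0 : 0 <= 2 * b / m%:R * s ^+ 2.
  by rewrite !mulr_ge0 ?sqr_ge0// invr_ge0 ltW.
have sE : s = \sum_(x : 'I_p * 'I_q) `|U x.1 x.2|.
  by rewrite /s /l1mx pair_bigA.
have [->|Unz] := eqVneq U 0; first by rewrite B0.
have {}s0 : 0 < s.
  rewrite lt_def s0 andbT; apply: contra Unz; rewrite sE psumr_eq0// => /allP h.
  apply/eqP/matrixP => i j; rewrite mxE; apply/eqP; rewrite -normr_eq0.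
  exact: (h (i, j) (mem_index_enum _)).
pose Q (x : 'I_p * 'I_q) := `|U x.1 x.2| / s.
pose e (x : 'I_p * 'I_q) : 'M[R]_(p, q) := (-1) ^+ (U x.1 x.2 < 0)%R *: delta_mx x.1 x.2.
have Q0 x : 0 <= Q x by rewrite divr_ge0// ltW.
have Q1 : \sum_x Q x = 1 by rewrite -mulr_suml -sE divff// gt_eqF.
have uE : \sum_x Q x *: e x = s^-1 *: U.
  rewrite [U in RHS]matrix_sum_delta scaler_sumr.
  rewrite (eq_bigr (fun i => \sum_j s^-1 *: (U i j *: delta_mx i j))); last first.
    by move=> i _; rewrite scaler_sumr.
  rewrite pair_bigA /=; apply: eq_bigr => -[i j] _ /=.
  rewrite /e /Q /= !scalerA -mulrA mulrCA; congr (_ *: _); congr (_ * _).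
  rewrite mulrC; have [h|h] := ltrP (U i j) 0; first by rewrite ltr0_norm// expr1 mulN1r opprK.
  by rewrite ger0_norm// expr0 mul1r.
have [l [sl al]] := maurey_sampling e Bsym Blin Q0 Q1 m 0.
rewrite uE !B0 !mulr0 !add0r BZ (Bsym U) BZ.
pose t' := [seq (x, U x.1 x.2 < 0) | x <- l].
have st' : size t' == m by rewrite size_map sl.
have -> : \sum_(i <- l) e i = atom_sum R (Tuple st').
  by rewrite /atom_sum /= big_map.
move=> hl; have {hl}H : m%:R * (m%:R - 1) * (s^-1 * (s^-1 * B U U))
    + m%:R * \sum_i Q i * B (e i) (e i) <= 0.
  apply: le_trans hl (HB _ _) => x /mapP[y yl ->] /=; have /allP/(_ y yl) := al.
  by rewrite /Q => h; rewrite -normr_eq0 gt_eqF//; move: h; rewrite pmulr_lgt0// invr_gt0.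
have Hs : - b <= \sum_i Q i * B (e i) (e i).
  rewrite -[- b]mul1r -Q1 mulr_suml; apply: ler_sum => i _; apply: ler_wpM2l => //.
  by rewrite /e BZ Bsym BZ mulrA -expr2 sqrr_sign mul1r.
have m1' : m%:R <= 2 * (m%:R - 1) :> R.
  have : (2 : R) <= m%:R by rewrite ler_nat.
  lra.
have H2 : m%:R * (m%:R - 1) * (s^-1 * (s^-1 * B U U)) <= m%:R * b.
  have : m%:R * - b <= m%:R * \sum_i Q i * B (e i) (e i) by rewrite ler_pM2l.
  by rewrite mulrN; lra.
have {H2} : (m%:R - 1) * B U U <= b * s ^+ 2.
  rewrite -mulrA ler_pM2l// in H2.
  have -> : (m%:R - 1) * B U U = (m%:R - 1) * (s^-1 * (s^-1 * B U U)) * s ^+ 2.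
    by field; rewrite gt_eqF.
  by rewrite ler_pM2r// exprn_gt0.
(* m <= 2 (m - 1) turns the factor m - 1 into m / 2 *)
have [|BU] := lerP (B U U) 0; first by move=> /le_trans h _; exact: h.
move=> H2; rewrite mulrAC ler_pdivlMr//.
have : m%:R * B U U <= 2 * (m%:R - 1) * B U U by rewrite ler_pM2r.
lra.
Qed.

(** * Quadratic forms and the smallest eigenvalue *)

Lemma nonneg_quadratic_discr (R : realFieldType) (a b c : R) : 0 <= a ->
  (forall t, 0 <= a * t ^+ 2 + 2 * b * t + c) -> b ^+ 2 <= a * c.
Proof.
rewrite le_eqVlt => /predU1P[<-|a0] H.
  have [->|b0] := eqVneq b 0; first by rewrite expr0n mul0r.
  have := H (- (c + 1) / (2 * b)).
  by rewrite mul0r add0r mulrA mulrAC divff ?mulf_neq0 ?pnatr_eq0// => ?; exfalso; lra.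
have := H (- b / a).
have -> : a * (- b / a) ^+ 2 + 2 * b * (- b / a) + c = (a * c - b ^+ 2) / a.
  by field; rewrite gt_eqF.
by rewrite pmulr_lge0 ?invr_gt0// subr_ge0.
Qed.

Section sum_of_squares.
Context (R : realType) (n : nat).
Implicit Types u v : 'cV[R]_n.

Definition dot u v : R := (u^T *m v) 0 0.

Lemma dotE u v : dot u v = \sum_i u i 0 * v i 0.
Proof. by rewrite /dot mxE; apply: eq_bigr => i _; rewrite mxE. Qed.

Lemma dotC u v : dot u v = dot v u.
Proof. by rewrite !dotE; apply: eq_bigr => i _; rewrite mulrC. Qed.

Lemma dotDl u v w : dot (u + v) w = dot u w + dot v w.
Proof. by rewrite /dot linearD mulmxDl mxE. Qed.

Lemma dotZl a u w : dot (a *: u) w = a * dot u w.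
Proof. by rewrite /dot linearZ -scalemxAl mxE. Qed.

Lemma dot0l w : dot 0 w = 0.
Proof. by rewrite -(scale0r 0) dotZl mul0r. Qed.

Lemma dotvv u : dot u u = \sum_i u i 0 ^+ 2.
Proof. by rewrite dotE; apply: eq_bigr => i _; rewrite expr2. Qed.

Lemma dot_ge0 u : 0 <= dot u u.
Proof. by rewrite dotvv sumr_ge0// => i _; rewrite sqr_ge0. Qed.

Lemma l2norm_sqr u : l2norm u ^+ 2 = dot u u.
Proof. by rewrite /l2norm sqr_sqrtr -?dotvv// dot_ge0. Qed.

Lemma dot_eq0 u : (dot u u == 0) = (u == 0).
Proof.
apply/idP/eqP => [|->]; last by rewrite dotvv big1// => i _; rewrite mxE expr0n.
rewrite dotvv psumr_eq0; last by move=> i _; rewrite sqr_ge0.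
move=> /allP H; apply/matrixP => i j; rewrite ord1 mxE; apply/eqP.
by rewrite -sqrf_eq0; exact: (H i (mem_index_enum _)).
Qed.

Lemma l2norm_ge0 u : 0 <= l2norm u.
Proof. exact: sqrtr_ge0. Qed.

Lemma l2norm_eq0 u : (l2norm u == 0) = (u == 0).
Proof. by rewrite -dot_eq0 -l2norm_sqr sqrf_eq0. Qed.

Lemma l2normZ a u : l2norm (a *: u) = `|a| * l2norm u.
Proof.
have -> : l2norm (a *: u) = Num.sqrt (dot (a *: u) (a *: u)) by rewrite -l2norm_sqr sqrtr_sqr ger0_norm// l2norm_ge0.
rewrite dotZl dotC dotZl mulrA -expr2 sqrtrM ?sqr_ge0// sqrtr_sqr -l2norm_sqr.
by rewrite sqrtr_sqr (ger0_norm (l2norm_ge0 _)).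
Qed.

Lemma sqr_dot_le u v : dot u v ^+ 2 <= dot u u * dot v v.
Proof.
apply: nonneg_quadratic_discr; first exact: dot_ge0.
move=> t; have := dot_ge0 (t *: u + v).
rewrite dotDl dotZl !(dotC _ (_ + _)) !dotDl !dotZl (dotC v u).
by congr (_ <= _); ring.
Qed.

Lemma sqr_entry_le_dot u i : u i 0 ^+ 2 <= dot u u.
Proof.
by rewrite dotvv (bigD1 i)//= lerDl sumr_ge0// => j _; rewrite sqr_ge0.
Qed.

End sum_of_squares.

Section smallest_eigenvalue.
Context (R : realType) (p : nat).
Implicit Types (S M : 'M[R]_p) (u v : 'cV[R]_p).

Lemma quad_formE M u : quad_form M u = dot u (M *m u).
Proof. by rewrite /quad_form /dot mulmxA. Qed.

Lemma sym_dot M u v : M^T = M -> dot u (M *m v) = dot v (M *m u).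
Proof. by move=> SM; rewrite dotC /dot trmx_mul SM !mulmxA. Qed.

Lemma psd_sqr_dot_le M u v : M^T = M -> (forall x, 0 <= quad_form M x) ->
  dot u (M *m v) ^+ 2 <= quad_form M u * quad_form M v.
Proof.
move=> SM M0; apply: nonneg_quadratic_discr => // t.
have := M0 (t *: u + v); rewrite !quad_formE mulmxDr -scalemxAr.
rewrite dotDl dotZl !(dotC _ (_ + _)) !dotDl !dotZl.
rewrite !(dotC (M *m _)) (sym_dot v u SM).
by congr (_ <= _); ring.
Qed.

Lemma quad_form_le_entries M u :
  quad_form M u <= (\sum_i \sum_j `|M i j|) * dot u u.
Proof.
rewrite quad_formE dotE mulr_suml; apply: ler_sum => i _.
rewrite mxE mulr_suml mulr_sumr; apply: ler_sum => j _.
rewrite mulrCA (le_trans (ler_norm _))// normrM ler_wpM2l//.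
have := sqr_entry_le_dot u i; have := sqr_entry_le_dot u j.
have := sqr_ge0 (`|u i 0| - `|u j 0|); rewrite sqrrB !real_normK ?num_real// normrM.
by rewrite -mulr_natr; lra.
Qed.

(** The infimum mu of the Rayleigh quotient is an eigenvalue. Otherwise the
    positive semidefinite matrix M = S - mu would be invertible, and
    Cauchy-Schwarz for M at x and M^-1 x gives
    |x|^4 <= (x^T M x) (x^T M^-1 x) <= C (x^T M x) |x|^2, so mu + C^-1 would still be a lower
    bound of the quotient. *)
Lemma lambda_min_quad S : S^T = S -> (forall x, 0 <= quad_form S x) ->
  0 <= lambda_min S /\ forall u, lambda_min S * dot u u <= quad_form S u.
Proof.
move=> SS S0.
have eig0 a : eigenvalue S a -> 0 <= a.
  move=> /eigenvalueP[v vS vn0]; have := S0 v^T.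
  have vn0' : v^T != 0 by rewrite trmx_eq0.
  rewrite /quad_form trmxK vS -scalemxAl mxE.
  have -> : (v *m v^T) 0 0 = dot v^T v^T by rewrite /dot trmxK.
  rewrite pmulr_lge0// lt_def dot_ge0 andbT dot_eq0//.
have lam0 : 0 <= lambda_min S.
  have [E0|/set0P E0] := eqVneq [set a : R | eigenvalue S a] set0.
    by rewrite /lambda_min E0 inf0.
  by apply: lb_le_inf => // a /eig0.
split => // u.
pose E := [set x | exists2 u : 'cV[R]_p, dot u u = 1 & x = quad_form S u].
have [->|un0] := eqVneq u 0.
  by rewrite quad_formE !dot0l mulr0.
have unit_of v : v != 0 -> dot ((l2norm v)^-1 *: v) ((l2norm v)^-1 *: v) = 1.
  move=> vn0; rewrite dotZl dotC dotZl -l2norm_sqr.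
  by field; rewrite l2norm_eq0.
have quadZ a v M : quad_form M (a *: v) = a ^+ 2 * quad_form M v.
  by rewrite !quad_formE -scalemxAr dotZl dotC dotZl (dotC _ v); ring.
have E0 : E !=set0 by exists (quad_form S ((l2norm u)^-1 *: u)); exists ((l2norm u)^-1 *: u); rewrite ?unit_of.
have lE : lbound E 0 by move=> x [v _ ->].
have hE : has_lbound E by exists 0.
pose mu := inf E; pose M := S - mu%:M.
have quadM v : quad_form M v = quad_form S v - mu * dot v v.
  by rewrite !quad_formE mulmxBl mul_scalar_mx !(dotC v) dotDl -scaleNr dotZl mulNr.
have MS : M^T = M by rewrite /M linearB /= SS tr_scalar_mx.
have M0 v : 0 <= quad_form M v.
  have [->|vn0] := eqVneq v 0; first by rewrite quad_formE dot0l.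
  have : 0 <= quad_form M ((l2norm v)^-1 *: v).
    rewrite quadM unit_of// mulr1 subr_ge0; apply: ge_inf => //.
    by exists ((l2norm v)^-1 *: v) => //; exact: unit_of.
  rewrite quadZ pmulr_rge0// exprn_gt0// invr_gt0 lt_def l2norm_ge0 andbT.
  by rewrite l2norm_eq0.
have nu : M \notin unitmx.
  (* invertibility would leave room below the infimum *)
  apply/negP => uM.
  pose C := \sum_i \sum_j `|invmx M i j|.
  have C0 : 0 <= C by apply: sumr_ge0 => i _; apply: sumr_ge0.
  have low x : dot x x = 1 -> 1 <= quad_form M x * C.
    move=> x1; have := psd_sqr_dot_le x (invmx M *m x) MS M0.
    rewrite mulmxA mulmxV// mul1mx x1 expr1n => h; apply: (le_trans h).
    apply: ler_wpM2l => //; rewrite quad_formE mulmxA mulmxV// mul1mx dotC -quad_formE.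
    by apply: le_trans (quad_form_le_entries _ _) _; rewrite x1 mulr1.
  have Cgt : 0 < C.
    rewrite lt_def C0 andbT; apply/eqP => Ce; have := low _ (unit_of _ un0).
    by rewrite Ce mulr0 ler10.
  have : mu + C^-1 <= mu.
    apply: lb_le_inf => // _ [x x1 ->]; have := low _ x1.
    by rewrite -ler_pdivrMr// quadM x1; lra.
  by rewrite gerDl leNgt invr_gt0 Cgt.
have emu : eigenvalue S mu.
  by rewrite /eigenvalue /eigenspace kermx_eq0 row_free_unit.
have : 0 <= quad_form M u := M0 u.
rewrite quadM subr_ge0; apply: le_trans; apply: ler_wpM2r; first exact: dot_ge0.
by apply: ge_inf => //; exists 0 => a /eig0.
Qed.

End smallest_eigenvalue.

(** * Measurable events and integrals of real functions *)

Section measurability.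
Context d (T : measurableType d) (R : realType).

Lemma measurable_dot (n : nat) (f : T -> 'cV[R]_n) :
  (forall i, measurable_fun setT (fun w => f w i 0)) ->
  measurable_fun setT (fun w => dot (f w) (f w)).
Proof.
move=> mf; rewrite (_ : (fun w => _) = (fun w => \sum_i f w i 0 ^+ 2)); last first.
  by apply/funext => w; rewrite dotvv.
by apply: measurable_sum => i; exact: measurable_funX.
Qed.

Lemma measurable_ge (f : T -> R) (c : R) : measurable_fun setT f ->
  measurable [set w | c <= f w].
Proof.
move=> mf; rewrite (_ : [set w | _] = f @^-1` `[c, +oo[); last first.
  by apply/seteqP; split => w; rewrite /= in_itv/= andbT.
by rewrite -[_ @^-1` _]setTI; apply: mf.
Qed.

Lemma measurable_le (f : T -> R) (c : R) : measurable_fun setT f ->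
  measurable [set w | f w <= c].
Proof.
move=> mf; rewrite (_ : [set w | _] = f @^-1` `]-oo, c]); last first.
  by apply/seteqP; split => w; rewrite /= in_itv/=.
by rewrite -[_ @^-1` _]setTI; apply: mf.
Qed.

Lemma measurable_gt (f : T -> R) (c : R) : measurable_fun setT f ->
  measurable [set w | c < f w].
Proof.
move=> mf; rewrite (_ : [set w | _] = f @^-1` `]c, +oo[); last first.
  by apply/seteqP; split => w; rewrite /= in_itv/= andbT.
by rewrite -[_ @^-1` _]setTI; apply: mf.
Qed.

Lemma measurable_bigcap_countable (I : countType) (S : I -> set T) :
  (forall i, measurable (S i)) -> measurable [set w | forall i, S i w].
Proof.
move=> mS; rewrite (_ : [set w | _] = \bigcap_k (if choice.unpickle k is Some i then S i else setT)).
  by apply: bigcapT_measurable => k; case: choice.unpickle.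
apply/seteqP; split => w /= H.
  by move=> k _; case: choice.unpickle.
by move=> i; have := H (choice.pickle i) Logic.I; rewrite choice.pickleK.
Qed.

End measurability.

Section integral_of_real_functions.
Context d (T : measurableType d) (R : realType) (P : measure T R).
Local Open Scope ereal_scope.
Implicit Types f g : T -> R.

Lemma ge0_integral_EFinZl c f : (0 <= c)%R -> measurable_fun setT f ->
  (forall w, 0 <= f w)%R -> \int[P]_w (c * f w)%:E = c%:E * \int[P]_w (f w)%:E.
Proof.
move=> c0 mf f0; rewrite -ge0_integralZl_EFin//.
- by move=> w _; rewrite lee_fin.
- exact/measurable_EFinP.
Qed.

Lemma ge0_integral_EFinD f g : measurable_fun setT f -> measurable_fun setT g ->
  (forall w, 0 <= f w)%R -> (forall w, 0 <= g w)%R ->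
  \int[P]_w (f w + g w)%:E = \int[P]_w (f w)%:E + \int[P]_w (g w)%:E.
Proof.
move=> mf mg f0 g0; rewrite -ge0_integralD//.
- by move=> w _; rewrite lee_fin.
- exact/measurable_EFinP.
- by move=> w _; rewrite lee_fin.
- exact/measurable_EFinP.
Qed.

Lemma ge0_le_integral_EFin f g : measurable_fun setT f -> measurable_fun setT g ->
  (forall w, 0 <= f w)%R -> (forall w, f w <= g w)%R ->
  \int[P]_w (f w)%:E <= \int[P]_w (g w)%:E.
Proof.
move=> mf mg f0 fg; apply: ge0_le_integral => //.
- by move=> w _; rewrite lee_fin.
- exact/measurable_EFinP.
- exact/measurable_EFinP.
- by move=> w _; rewrite lee_fin.
Qed.

End integral_of_real_functions.

(** * Exponential moments of squared sub-Gaussian variables *)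

Section exponential_inequalities.
Context (R : realType).
Implicit Types x y : R.

Lemma expR_le_1Dmul y : expR y <= 1 + y * expR y.
Proof.
have := expR_ge1Dx (- y); rewrite expRN -(ler_pM2r (expR_gt0 y)) mulVf ?gt_eqF ?expR_gt0//.
lra.
Qed.

Lemma expR_le_quadratic y : expR y <= 1 + y + y ^+ 2 * expR `|y|.
Proof.
have h := expR_le_1Dmul y.
have [y0|y0] := lerP 0 y.
  rewrite (ger0_norm y0); have : y * expR y <= y * (1 + y * expR y) by rewrite ler_wpM2l.
  lra.
have h1 : y * expR y <= y * (1 + y) by rewrite ler_nM2l// expR_ge1Dx.
have : y ^+ 2 * 1 <= y ^+ 2 * expR `|y|.
  by rewrite ler_wpM2l ?sqr_ge0// -expR0 ler_expR.
lra.
Qed.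

Lemma expR_mul_le_quadratic (t q : R) : `|t| <= 1 / 2 -> 0 <= q ->
  expR (t * q) <= 1 + t * q + 8 * t ^+ 2 * expR q.
Proof.
move=> t2 q0; apply: (le_trans (expR_le_quadratic _)); rewrite lerD2l.
have qq : q ^+ 2 <= 8 * expR (q / 2).
  have h : 0 <= q / 2 by lra.
  have := expR_ge1Dxn 1 h.
  have -> : 2`!%:R = 2 :> R by []; lra.
have e2 : expR `|t * q| <= expR (q / 2).
  by rewrite ler_expR normrM (ger0_norm q0); have := ler_wpM2r q0 t2; lra.
have -> : 8 * t ^+ 2 * expR q = t ^+ 2 * (8 * expR (q / 2) * expR (q / 2)).
  have -> : expR q = expR (q / 2) * expR (q / 2) by rewrite -expRD; congr expR; field.
  by ring.
rewrite exprMn -[leLHS]mulrA; apply: ler_wpM2l; first exact: sqr_ge0.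
by apply: ler_pM => //; rewrite ?sqr_ge0 ?expR_ge0.
Qed.

Lemma expr2n_le_expR (k : nat) : (2 ^ k)%:R <= expR (k%:R : R).
Proof.
rewrite natrX -[in X in expR X](mulr1 k%:R) expRM_natl lerXn2r// ?nnegrE ?expR_ge0//.
by have := expR_ge1Dx (1 : R); lra.
Qed.

(** Completing the square: - (3/2) k^2 + k |x| is maximal at k = |x| / 3, with
    value x^2 / 6, and rounding |x| / 3 down loses at most 3 / 2. This makes
    expR (x^2 / 6) smaller than a countable mixture of exponentials of linear
    functions, the discrete counterpart of Gaussian mixing. *)
Lemma expR_sqr_le_term x : exists k : nat,
  expR (x ^+ 2 / 6) <= expR (3 / 2) *
    (expR (- (3 / 2) * k%:R ^+ 2) * (expR (k%:R * x) + expR (- k%:R * x))).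
Proof.
have x30 : 0 <= `|x| / 3 by rewrite divr_ge0.
exists (Num.trunc (`|x| / 3)); set k := Num.trunc _.
have /andP[k1 k2] := truncn_itv x30; rewrite -/k in k1 k2.
rewrite -[k.+1%:R]natr1 in k2.
apply: (@le_trans _ _ (expR (3 / 2) * (expR (- (3 / 2) * k%:R ^+ 2) * expR (k%:R * `|x|)))).
  rewrite -!expRD ler_expR -(real_normK (num_real x)).
  have d0 : 0 <= `|x| / 3 - k%:R by rewrite subr_ge0.
  have d1 : `|x| / 3 - k%:R <= 1 by lra.
  have := exprn_ile1 2 d0 d1; move: (k%:R : R) `|x| => K X; lra.
rewrite !ler_pM2l ?expR_gt0//; case: (ger0P x) => _.
  by rewrite lerDl expR_ge0.
by rewrite mulrN -mulNr lerDr expR_ge0.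
Qed.

End exponential_inequalities.

Section sub_gaussian_square.
Context d (T : measurableType d) (R : realType) (P : probability T R).
Local Open Scope ereal_scope.

Lemma zero_mean_sub_gaussian_mgf (U : T -> R) (s2 tau t : R) :
  sub_gaussian P U s2 -> 'E_P[U] = 0 -> (s2 <= tau ^+ 2)%R -> (0 < tau)%R ->
  \int[P]_w (expR (t * (U w / tau)))%:E <= (expR (t ^+ 2 / 2))%:E.
Proof.
move=> [_ /(_ (t / tau)%R) H] U0 s2t t0; move: H; rewrite /mean U0 /= unlock => H.
rewrite (eq_integral (fun w => (expR (t / tau * (U w - 0)))%:E)); last first.
  by move=> w _; congr (expR _)%:E; rewrite subr0; ring.
apply: (le_trans H); rewrite lee_fin ler_expR.
have -> : (s2 * (t / tau) ^+ 2 / 2 = (s2 / tau ^+ 2) * (t ^+ 2 / 2))%R.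
  by field; rewrite gt_eqF.
rewrite ler_piMl ?divr_ge0 ?sqr_ge0//.
by rewrite ler_pdivrMr ?exprn_gt0// mul1r.
Qed.

(** Integrate the mixture of expR_sqr_le_term: its k-th term has integral at most
    2 exp(- (3/2) k^2 + k^2 / 2) = 2 exp(- k^2) <= 2 / 2^k. The total is at most
    4 exp(3 / 2) <= exp 4. *)
Lemma sub_gaussian_expR_sqr (U : T -> R) (s2 tau : R) :
  sub_gaussian P U s2 -> 'E_P[U] = 0 -> (s2 <= tau ^+ 2)%R -> (0 < tau)%R ->
  \int[P]_w (expR (U w ^+ 2 / (6 * tau ^+ 2)))%:E <= (expR 4)%:E.
Proof.
move=> sU U0 s2t t0.
have /Lfun1_integrable/measurable_int/measurable_EFinP mU := sU.1.
pose x w := (U w / tau)%R.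
have mx : measurable_fun setT x by exact: measurable_funM.
pose a (k : nat) : R := expR (- (3 / 2) * k%:R ^+ 2).
pose g (k : nat) w : R := (a k * (expR (k%:R * x w) + expR (- k%:R * x w)))%R.
have mexp c : measurable_fun setT (fun w => expR (c * x w)).
  by apply: measurableT_comp => //; exact: measurable_funM.
have mg k : measurable_fun setT (g k).
  by apply: measurable_funM => //; exact: measurable_funD.
have g0 k w : (0 <= g k w)%R by rewrite mulr_ge0 ?addr_ge0 ?expR_ge0.
have intg k : \int[P]_w (g k w)%:E <= (4 / (2 ^ k.+1)%:R)%:E.
  rewrite /g ge0_integral_EFinZl ?expR_ge0//=; last exact: measurable_funD.
  rewrite ge0_integral_EFinD//=.
  have h1 := zero_mean_sub_gaussian_mgf k%:R sU U0 s2t t0.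
  have h2 := zero_mean_sub_gaussian_mgf (- k%:R)%R sU U0 s2t t0.
  have : (a k)%:E * (\int[P]_w (expR (k%:R * x w))%:E + \int[P]_w (expR (- k%:R * x w))%:E)
      <= (a k)%:E * (expR (k%:R ^+ 2 / 2) + expR (k%:R ^+ 2 / 2))%:E.
    apply: lee_wpmul2l; first by rewrite lee_fin expR_ge0.
    by rewrite EFinD; apply: leeD => //; rewrite sqrrN in h2.
  move=> /le_trans; apply; rewrite -EFinM lee_fin.
  have -> : (a k * (expR (k%:R ^+ 2 / 2) + expR (k%:R ^+ 2 / 2)) = 2 * expR (- k%:R ^+ 2))%R.
    have -> : expR (- k%:R ^+ 2) = (a k * expR (k%:R ^+ 2 / 2))%R :> R.
      by rewrite /a -expRD; congr expR; field.
    by ring.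
  rewrite expnS natrM expRN.
  have -> : (4 / (2 * (2 ^ k)%:R) = 2 * (2 ^ k)%:R^-1 :> R)%R.
    by field; rewrite pnatr_eq0 -lt0n expn_gt0.
  rewrite ler_pM2l// lef_pV2 ?posrE ?expR_gt0 ?ltr0n ?expn_gt0//.
  apply: le_trans (expr2n_le_expR _ k) _; rewrite ler_expR -natrX ler_nat.
  by rewrite expnS expn1; case: (k) => // j; rewrite leq_pmulr.
pose F w := (expR (3 / 2))%:E * \sum_(0 <= k <oo) (g k w)%:E.
have mF : measurable_fun setT (fun w => \sum_(0 <= k <oo) (g k w)%:E).
  have mE k : measurable_fun setT (fun w => (g k w)%:E) by exact/measurable_EFinP.
  apply: (@ge0_emeasurable_sum _ _ _ _ (fun k w => (g k w)%:E) xpredT) => //.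
  by move=> k w _ _; rewrite lee_fin.
(* expR_sqr_le_term bounds the integrand by a single term of the series F *)
apply: (@le_trans _ _ (\int[P]_w F w)).
  apply: ge0_le_integral => //.
  - apply/measurable_EFinP; apply: measurableT_comp => //.
    by apply: measurable_funM => //; exact: measurable_funX.
  - by apply: emeasurable_funM => //.
  - move=> w _; have [k hk] := expR_sqr_le_term (x w).
    have -> : (U w ^+ 2 / (6 * tau ^+ 2) = x w ^+ 2 / 6)%R.
      by rewrite /x; field; rewrite gt_eqF.
    apply: (@le_trans _ _ ((expR (3 / 2))%:E * (g k w)%:E)).
      by rewrite -EFinM lee_fin.
    apply: lee_wpmul2l; first by rewrite lee_fin expR_ge0.
    apply: (le_trans _ (@nneseries_lim_ge _ (fun k => (g k w)%:E) xpredT 0 k.+1 _)); last first.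
      by move=> n _ _; rewrite lee_fin.
    rewrite big_nat_recr//= leeDr// sume_ge0// => i _.
    by rewrite lee_fin.
rewrite /F ge0_integralZl//=; last first.
  by move=> w _; apply: nneseries_ge0 => k _ _; rewrite lee_fin.
rewrite integral_nneseries//; last 2 first.
- by move=> k; exact/measurable_EFinP.
- by move=> k w _; rewrite lee_fin.
have : \sum_(0 <= k <oo) \int[P]_w (g k w)%:E <= 4%:E.
  apply: (le_trans _ (@epsilon_trick0 R 4 xpredT _)) => //.
  apply: lee_nneseries => // k _ _.
  by apply: integral_ge0 => w _; rewrite lee_fin.
move=> h; apply: (@le_trans _ _ ((expR (3 / 2))%:E * 4%:E)).
  by apply: lee_wpmul2l => //; rewrite lee_fin expR_ge0.
rewrite -EFinM lee_fin.
have h2 : (4 <= expR 2 :> R)%R.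
  by apply: (le_trans _ (expr2n_le_expR _ 2)); rewrite ler_nat.
apply: (@le_trans _ _ (expR (3 / 2) * expR 2)%R).
  by rewrite ler_pM2l ?expR_gt0.
by rewrite -expRD ler_expR; lra.
Qed.

End sub_gaussian_square.

Section moments_of_the_square.
Context d (T : measurableType d) (R : realType) (P : probability T R).
Local Open Scope ereal_scope.

Lemma integrable_of_expR (q : T -> R) : measurable_fun setT q ->
  (forall w, 0 <= q w)%R -> \int[P]_w (expR (q w))%:E <= (expR 4)%:E ->
  P.-integrable setT (EFin \o (fun w => expR (q w))) /\
  P.-integrable setT (EFin \o q).
Proof.
move=> mq q0 Hq.
have me : measurable_fun setT (fun w => expR (q w)) by exact: measurableT_comp.
have ie : P.-integrable setT (EFin \o (fun w => expR (q w))).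
  apply/integrableP; split; first exact/measurable_EFinP.
  apply: (@le_lt_trans _ _ (expR 4)%:E); last by rewrite ltry.
  by under eq_integral do rewrite /= ger0_norm ?expR_ge0//.
split => //; apply: le_integrable ie => //; first exact/measurable_EFinP.
move=> w _ /=; rewrite lee_fin !ger0_norm ?expR_ge0//.
by have := expR_ge1Dx (q w); lra.
Qed.

(** Second-order expansion of the exponential: the linear term cancels after
    centring, and q^2 expR (|t| q) <= 8 expR q when |t| <= 1 / 2. *)
Lemma centered_mgf_le (q : T -> R) (t : R) : measurable_fun setT q ->
  (forall w, 0 <= q w)%R -> \int[P]_w (expR (q w))%:E <= (expR 4)%:E ->
  (`|t| <= 1 / 2)%R ->
  \int[P]_w (expR (t * (q w - fine (\int[P]_w (q w)%:E))))%:E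
    <= (expR (8 * expR 4 * t ^+ 2))%:E.
Proof.
move=> mq q0 Hq t2; have [ie iq] := integrable_of_expR mq q0 Hq.
set v := fine _; have vE : \int[P]_w (q w)%:E = v%:E.
  by rewrite fineK//; exact: integrable_fin_num iq.
have mt : measurable_fun setT (fun w => expR (t * q w)).
  by apply: measurableT_comp => //; exact: measurable_funM.
have E w : (expR (t * (q w - v)))%:E = (expR (- (t * v)) * expR (t * q w))%:E.
  by rewrite -expRD; congr (expR _)%:E; ring.
under eq_integral do rewrite E.
rewrite ge0_integral_EFinZl ?expR_ge0//.
have H : \int[P]_w (expR (t * q w))%:E <= (1 + t * v + 8 * t ^+ 2 * expR 4)%:E.
  apply: (@le_trans _ _ (\int[P]_w (1 + t * q w + 8 * t ^+ 2 * expR (q w))%:E)).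
    apply: ge0_le_integral_EFin => //.
    - apply: measurable_funD; first by apply: measurable_funD => //; exact: measurable_funM.
      by apply: measurable_funM => //; exact: measurableT_comp.
    - by move=> w; exact: expR_mul_le_quadratic.
  have i1 : P.-integrable setT (EFin \o cst 1%R) by exact: finite_measure_integrable_cst.
  have i2 : P.-integrable setT (EFin \o (fun w => t * q w)%R).
    by have := integrableZl measurableT t iq; apply: eq_integrable => // w _ /=.
  have i3 : P.-integrable setT (EFin \o (fun w => 8 * t ^+ 2 * expR (q w))%R).
    by have := integrableZl measurableT (8 * t ^+ 2)%R ie; apply: eq_integrable => // w _ /=.
  have i12 : P.-integrable setT (EFin \o (fun w => 1 + t * q w)%R).
    by have := integrableD measurableT i1 i2; apply: eq_integrable => // w _ /=.
  rewrite (@integralD_EFin _ _ _ P setT measurableT (fun w => 1 + t * q w)%R _ i12 i3).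
  rewrite (@integralD_EFin _ _ _ P setT measurableT (cst 1%R) _ i1 i2).
  have -> : \int[P]_w (8 * t ^+ 2 * expR (q w))%:E = (8 * t ^+ 2)%:E * \int[P]_w (expR (q w))%:E.
    by rewrite -integralZl//; apply: eq_integral => w _; rewrite EFinM.
  have -> : \int[P]_w (t * q w)%:E = (t * v)%:E.
    by rewrite EFinM -vE -integralZl//; apply: eq_integral => w _; rewrite EFinM.
  have -> : \int[P]_w (EFin \o cst 1%R) w = 1%:E.
    by rewrite /= integral_cst//= probability_setT mule1.
  rewrite (EFinD (1 + t * v)) (EFinD 1) (EFinM (8 * t ^+ 2)); apply: leeD => //.
  by apply: lee_wpmul2l => //; rewrite lee_fin mulr_ge0 ?sqr_ge0.
apply: (@le_trans _ _ ((expR (- (t * v)))%:E * (1 + t * v + 8 * t ^+ 2 * expR 4)%:E)).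
  by apply: lee_wpmul2l => //; rewrite lee_fin expR_ge0.
rewrite -EFinM lee_fin.
have -> : expR (8 * expR 4 * t ^+ 2) = (expR (- (t * v)) * expR (t * v + 8 * t ^+ 2 * expR 4))%R.
  by rewrite -expRD; congr expR; ring.
rewrite ler_pM2l ?expR_gt0//.
by have := expR_ge1Dx (t * v + 8 * t ^+ 2 * expR 4)%R; lra.
Qed.

End moments_of_the_square.

(** * Independent products and the Chernoff bound *)

Import HBNNSimple.

Section products_of_independent_variables.
Context d d' (T : measurableType d) (T' : measurableType d') (R : realType)
  (P : probability T R).
Local Open Scope ereal_scope.

(** Extends a factorization from indicators to nonnegative measurable functions,
    first to simple functions by linearity, then by monotone convergence. *)
Lemma factor_measurable (G : T -> R) (Y : T -> T') (c : R) (f : T' -> R) :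
  measurable_fun setT G -> (forall w, 0 <= G w)%R -> measurable_fun setT Y ->
  measurable_fun setT f -> (forall y, 0 <= f y)%R ->
  (forall B, measurable B ->
     \int[P]_w (G w * \1_B (Y w))%:E = c%:E * \int[P]_w (\1_B (Y w))%:E) ->
  \int[P]_w (G w * f (Y w))%:E = c%:E * \int[P]_w (f (Y w))%:E.
Proof.
move=> mG G0 mY mf f0 H.
have mfE : measurable_fun setT (EFin \o f) by exact/measurable_EFinP.
pose fn := nnsfun_approx measurableT mfE.
have fn0 n y : (0 <= fn n y)%R by exact: fun_ge0.
have mfn n : measurable_fun setT (fun w => fn n (Y w)).
  exact: (measurableT_comp (f := fn n)).
have step n : \int[P]_w (G w * fn n (Y w))%:E = c%:E * \int[P]_w (fn n (Y w))%:E.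
  have mI r : measurable (fn n @^-1` [set r]).
    exact: (measurable_funPTI (fn n) (measurable_set1 r)).
  have m1 r : measurable_fun setT (fun w => \1_(fn n @^-1` [set r]) (Y w) : R).
    have mi : measurable_fun setT (\1_(fn n @^-1` [set r]) : T' -> R) by exact: measurable_indic.
    exact: measurableT_comp mi mY.
  have r0 r w : (0 <= r * \1_(fn n @^-1` [set r]) (Y w))%R.
    have [r0|r0] := lerP 0 r; first by rewrite mulr_ge0.
    rewrite indicE memNset ?mulr0// => /= E.
    by have := fn0 n (Y w); rewrite E leNgt r0.
  have key (F : T -> R) : measurable_fun setT F -> (forall w, 0 <= F w)%R ->
     \int[P]_w (F w * fn n (Y w))%:E = \sum_(r <- fset_set (range (fn n)))
       (r%:E * \int[P]_w (F w * \1_(fn n @^-1` [set r]) (Y w))%:E).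
    move=> mF F0.
    under eq_integral => w _ do rewrite (fimfunE (fn n)) fsbig_finite//= mulr_sumr -sumEFin.
    rewrite ge0_integral_sum//=; last 2 first.
    - move=> r; apply/measurable_EFinP; apply: measurable_funM => //; exact: measurable_funM.
    - by move=> r w _; rewrite lee_fin mulr_ge0.
    apply: eq_big_seq => r; rewrite in_fset_set// => /set_mem[y _ <-].
    rewrite -ge0_integral_EFinZl//; last 2 first.
    - exact: measurable_funM.
    - by move=> w; rewrite mulr_ge0.
    by apply: eq_integral => w _; congr (_%:E); rewrite mulrCA.
  have key1 : \int[P]_w (fn n (Y w))%:E = \sum_(r <- fset_set (range (fn n)))
       (r%:E * \int[P]_w (\1_(fn n @^-1` [set r]) (Y w))%:E).
    have := key (cst 1%R) (measurable_cst _) (fun=> ler01).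
    rewrite (eq_integral (fun w => (fn n (Y w))%:E)); last by move=> w _; rewrite mul1r.
    move=> ->; apply: eq_bigr => r _; congr (_ * _).
    by apply: eq_integral => w _; rewrite mul1r.
  rewrite key// key1 big_seq [in RHS]big_seq ge0_sume_distrr; last first.
    move=> r; rewrite in_fset_set// => /set_mem[y _ <-]; apply: mule_ge0; rewrite ?lee_fin//.
    by apply: integral_ge0 => w _; rewrite lee_fin.
  apply: eq_bigr => r _; rewrite H//.
  by rewrite muleCA.
have cv (F : T -> R) : measurable_fun setT F -> (forall w, 0 <= F w)%R ->
   (\int[P]_w (F w * fn n (Y w))%:E @[n --> \oo] --> \int[P]_w (F w * f (Y w))%:E).
  move=> mF F0.
  have -> : \int[P]_w (F w * f (Y w))%:E =
     \int[P]_w (limn (fun n => (F w * fn n (Y w))%:E)).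
    apply: eq_integral => w _; apply/esym/cvg_lim => //.
    have fE0 y : [set: T'] y -> (0 <= (EFin \o f) y)%E by rewrite lee_fin.
    have hc := cvg_nnsfun_approx measurableT mfE fE0 (I : [set: T'] (Y w)).
    exact: (@cvgeZl _ _ _ _ _ (F w)%:E _ hc).
  apply: cvg_monotone_convergence => //.
  - by move=> n; apply/measurable_EFinP; exact: measurable_funM.
  - by move=> n w _; rewrite lee_fin mulr_ge0.
  - move=> w _ n m nm; rewrite lee_fin ler_wpM2l//.
    by have /lefP := nd_nnsfun_approx measurableT mfE nm; apply.
have h1 := cv G mG G0.
have h2 := cv (cst 1%R) (measurable_cst _) (fun=> ler01).
have {}h2 : (c%:E * \int[P]_w (fn n (Y w))%:E @[n --> \oo] --> c%:E * \int[P]_w (f (Y w))%:E).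
  apply: cvgeZl => //; move: h2.
  rewrite (eq_integral (fun w => (f (Y w))%:E)); last by move=> w _; rewrite mul1r.
  apply: cvg_trans; apply: near_eq_cvg; near=> n.
  by apply: eq_integral => w _; rewrite mul1r.
apply: (cvg_unique _ h1) => //.
rewrite (_ : (fun n => _) = (fun n => c%:E * \int[P]_w (fn n (Y w))%:E))//.
by apply/funext => n; exact: step.
Unshelve. all: by end_near. Qed.

End products_of_independent_variables.

Section chernoff_bound.
Context d d' (T : measurableType d) (T' : measurableType d') (R : realType)
  (P : probability T R) (n : nat) (X : 'I_n -> T -> T').
Hypothesis mX : forall i, measurable_fun setT (X i).
Hypothesis indX : mutually_independent P X.
Local Open Scope ereal_scope.

(** Indicators are replaced by general factors one index at a time; the
    statement for indicators is the product rule for independent events. *)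
Lemma independent_integral_prod (g : 'I_n -> T' -> R) (c : 'I_n -> R) :
  (forall i, measurable_fun setT (g i)) -> (forall i y, 0 <= g i y)%R ->
  (forall i, \int[P]_w (g i (X i w))%:E = (c i)%:E) ->
  \int[P]_w (\prod_(i < n) g i (X i w))%:E = (\prod_(i < n) c i)%:E.
Proof.
move=> mg g0 gc.
suff claim k : forall (g : 'I_n -> T' -> R) (c : 'I_n -> R),
    (forall i, measurable_fun setT (g i)) -> (forall i y, 0 <= g i y)%R ->
    (forall i, \int[P]_w (g i (X i w))%:E = (c i)%:E) ->
    (forall i : 'I_n, (k <= i)%N -> exists2 B, measurable B & g i = \1_B) ->
    \int[P]_w (\prod_(i < n) g i (X i w))%:E = (\prod_(i < n) c i)%:E.
  by apply: (claim n) => // i; rewrite leqNgt ltn_ord.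
elim: k => [|k IH] {mg g0 gc} {}g {}c mg g0 gc gB.
  have /choice[B HB] : forall i : 'I_n, exists B, measurable B /\ g i = \1_B.
    by move=> i; have [B mB gE] := gB i (leq0n _); exists B.
  have mI i : measurable (X i @^-1` B i).
    by rewrite -[_ @^-1` _]setTI; apply: mX => //; have [] := HB i.
  have cE i : P (X i @^-1` B i) = (c i)%:E.
    rewrite -gc -[X in P X]setIT -integral_indic//.
    by apply: eq_integral => w _; have [_ ->] := HB i.
  have <- : \prod_(i < n) P (X i @^-1` B i) = (\prod_(i < n) c i)%:E.
    rewrite (eq_bigr _ (fun i _ => cE i)).
    by elim/big_ind2 : _ => // x1 x2 y1 y2 -> ->; rewrite EFinM.
  rewrite -indX; last by move=> i; have [] := HB i.
  rewrite -[X in _ = P X]setIT -integral_indic//; last first.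
    by apply: fin_bigcap_measurable => // i _; exact: mI.
  apply: eq_integral => w _; congr (_%:E).
  have [h|/existsNP[i h]] := pselect (forall i, B i (X i w)).
    rewrite indicE mem_set; last by move=> i _; exact: h.
    by apply: big1 => i _; have [_ ->] := HB i; rewrite indicE mem_set.
  rewrite indicE memNset; last by move=> /(_ i I).
  by rewrite (bigD1 i)//=; have [_ ->] := HB i; rewrite indicE memNset ?mul0r.
have [nk|kn] := leqP n k.
  apply: IH => // i ki; have := ltn_ord i; rewrite ltnNge (leq_trans nk ki)//.
pose i0 := Ordinal kn.
pose G w := (\prod_(i < n | i != i0) g i (X i w))%R.
pose C := (\prod_(i < n | i != i0) c i)%R.
have mgX i : measurable_fun setT (fun w => g i (X i w)).
  exact: measurableT_comp.
have mG : measurable_fun setT G.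
  rewrite (_ : G = fun w => \prod_(i < n) if i != i0 then g i (X i w) else 1%R)%R; last first.
    by apply/funext => w; rewrite /G big_mkcond.
  by apply: measurable_prod => i _; case: (i != i0).
have G0 w : (0 <= G w)%R by apply: prodr_ge0.
have := @factor_measurable _ _ _ _ _ P G (X i0) C (g i0) mG G0 (mX i0) (mg i0) (g0 i0).
rewrite gc -EFinM (bigD1 i0)//= mulrC => <-; last first.
  move=> B mB.
  pose b := fine (\int[P]_w (\1_B (X i0 w))%:E).
  have bE : \int[P]_w (\1_B (X i0 w))%:E = b%:E.
    rewrite fineK// (eq_integral (fun w => (\1_(X i0 @^-1` B) w)%:E))//.
    rewrite integral_indic// ?fin_num_measure// ?setIT//.
    - by rewrite -[_ @^-1` _]setTI; exact: mX.
    - by rewrite -[_ @^-1` _]setTI; exact: mX.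
  have := IH (fun i => if i == i0 then \1_B else g i) (fun i => if i == i0 then b else c i).
  rewrite (bigD1 i0)//= eqxx bE -EFinM mulrC.
  rewrite [in RHS](eq_bigr c); last by move=> i /negPf ->.
  move=> <-.
  - apply: eq_integral => w _; rewrite (bigD1 i0)//= eqxx mulrC; congr (_ * _)%:E.
    by apply: eq_bigr => i /negPf ->.
  - move=> i; case: ifP => // _; exact: measurable_indic.
  - by move=> i y; case: ifP.
  - by move=> i; have [->|ne] := eqVneq i i0.
  - move=> i ki; have [_|ne] := eqVneq i i0; first by exists B.
    by apply: gB; rewrite ltn_neqAle ki andbT eq_sym; apply: contra ne => /eqP h; apply/eqP/val_inj.
by apply: eq_integral => w _; rewrite (bigD1 i0)//= mulrC.
Qed.

Lemma chernoff_sum (h : T' -> R) (a b : R) : measurable_fun setT h ->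
  (forall i, \int[P]_w (expR (h (X i w)))%:E <= (expR b)%:E) ->
  P [set w | a <= \sum_(i < n) h (X i w)]%R <= (expR (n%:R * b - a))%:E.
Proof.
move=> mh Hh.
have mhX i : measurable_fun setT (fun w => h (X i w)) by exact: measurableT_comp.
have mS : measurable_fun setT (fun w => \sum_(i < n) h (X i w))%R.
  by apply: measurable_sum.
set A := [set w | _]; have mA : measurable A by exact: measurable_ge.
pose c i := fine (\int[P]_w (expR (h (X i w)))%:E).
have cE i : \int[P]_w (expR (h (X i w)))%:E = (c i)%:E.
  rewrite fineK// ge0_fin_numE; first by rewrite (le_lt_trans (Hh i))// ltry.
  by apply: integral_ge0 => w _; rewrite lee_fin expR_ge0.
have cb i : (0 <= c i <= expR b)%R.
  rewrite -!lee_fin -cE Hh andbT.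
  by apply: integral_ge0 => w _; rewrite lee_fin expR_ge0.
have H := @independent_integral_prod (fun=> fun y => expR (h y)) c.
rewrite -(lee_pmul2l (x := (expR a)%:E))//; last first.
  by rewrite lte_fin expR_gt0.
rewrite -EFinM -expRD addrCA subrr addr0.
apply: (@le_trans _ _ (\int[P]_w (\prod_(i < n) expR (h (X i w)))%:E)).
  rewrite -[X in P X]setIT -(integral_indic _ _ mA)//.
  rewrite -ge0_integral_EFinZl ?expR_ge0//.
  apply: ge0_le_integral_EFin => //.
  - by apply: measurable_funM => //; exact: measurable_indic.
  - by apply: measurable_prod => i _; exact: measurableT_comp.
  - move=> w; rewrite -expR_sum indicE; case: (asboolP (A w)) => [Aw|nA].
      by rewrite mem_set// mulr1 ler_expR.
    by rewrite memNset// mulr0 expR_ge0.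
rewrite H//; last by move=> i; exact: measurableT_comp.
rewrite lee_fin expRM_natl.
have -> : (expR b ^+ n = \prod_(i < n) expR b)%R by rewrite prodr_const card_ord.
by apply: ler_prod => i _; exact: cb.
Qed.

End chernoff_bound.

(** * Tail bounds for one direction *)

Section sub_gaussian_rows.
Context d (T : measurableType d) (R : realType) (P : probability T R)
  (n m : nat) (A : T -> 'M[R]_(n, m)) (Sigma : 'M[R]_m) (s2 : R).
Implicit Types (u : 'cV[R]_m) (i : 'I_n).
Hypothesis subA : sub_gaussian_mx P A Sigma s2.
Local Open Scope ereal_scope.

Let rows := fun (i : 'I_n) w => row_tuple (A w) i.

(** Rows have to be read as tuples because independence is stated for the
    tuple-valued rows. *)
Definition tuple_dot (u : 'cV[R]_m) (x : m.-tuple R) : R :=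
  (\sum_(j < m) tnth x j * u j 0)%R.

Lemma tuple_dot_row u i w : tuple_dot u (rows i w) = (A w *m u) i 0%R.
Proof.
by rewrite /tuple_dot mxE; apply: eq_bigr => j _; rewrite tnth_mktuple.
Qed.

Lemma measurable_tuple_dot u : measurable_fun setT (tuple_dot u).
Proof.
by apply: measurable_sum => j; apply: measurable_funM => //; exact: measurable_tnth.
Qed.

Lemma measurable_sub_gaussian_entry i j : measurable_fun setT (fun w => A w i j).
Proof.
by have [_ /(_ i j)[/Lfun1_integrable/measurable_int/measurable_EFinP]] := subA.
Qed.

Lemma measurable_sub_gaussian_row u i : measurable_fun setT (fun w => (A w *m u) i 0%R).
Proof.
rewrite (_ : (fun w => _) = (fun w => \sum_j A w i j * u j 0)%R); last first.
  by apply/funext => w; rewrite mxE.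
apply: measurable_sum => j; apply: measurable_funM => //.
exact: measurable_sub_gaussian_entry.
Qed.

Lemma sub_gaussian_row_mean u i : 'E_P[fun w => (A w *m u) i 0%R] = 0.
Proof.
have [_ zA _ _] := subA; rewrite unlock.
have iA j : P.-integrable setT (fun w => (A w i j * u j 0%R)%:E).
  have /Lfun1_integrable := (zA i j).1 => /(integrableZl measurableT (u j 0%R)).
  by apply: eq_integrable => // w _ /=; rewrite -EFinM mulrC.
under eq_integral do rewrite mxE -sumEFin.
rewrite integral_sum//; apply: big1 => j _.
have iAj : P.-integrable setT (EFin \o (fun w => A w i j)).
  by have /Lfun1_integrable := (zA i j).1.
rewrite (eq_integral (fun w => (u j 0%R)%:E * (EFin \o (fun w => A w i j)) w)); last first.
  by move=> w _; rewrite /= -EFinM mulrC.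
rewrite integralZl//; have [_] := zA i j; rewrite unlock /= => ->.
by rewrite mule0.
Qed.

Lemma row_expR_sqr_le u i (tau : R) : l2norm u = 1%R -> (0 < tau)%R -> (s2 <= tau ^+ 2)%R ->
  \int[P]_w (expR ((A w *m u) i 0%R ^+ 2 / (6 * tau ^+ 2)))%:E <= (expR 4)%:E.
Proof.
move=> u1 t0 st; have [_ _ _ /(_ u i u1) sG] := subA.
exact: sub_gaussian_expR_sqr sG (sub_gaussian_row_mean u i) st t0.
Qed.

Lemma measurable_row_sqr u i (c : R) :
  measurable_fun setT (fun w => (A w *m u) i 0%R ^+ 2 / c)%R.
Proof.
apply: measurable_funM => //; apply: measurable_funX.
exact: measurable_sub_gaussian_row.
Qed.

Lemma integrable_row_sqr u i : l2norm u = 1%R ->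
  P.-integrable setT (fun w => ((A w *m u) i 0%R ^+ 2)%:E).
Proof.
(* any positive tau with s2 <= tau ^+ 2 would do *)
move=> u1; pose tau : R := (1 + `|s2|)%R.
have t0 : (0 < tau)%R by rewrite ltr_pwDl.
have st : (s2 <= tau ^+ 2)%R.
  have := ler_norm s2; have := normr_ge0 s2; rewrite /tau; move: `|s2|%R => z; nra.
have H := row_expR_sqr_le i u1 t0 st.
have c0 : (0 < 6 * tau ^+ 2)%R by rewrite mulr_gt0 ?exprn_gt0.
have q0 w : (0 <= (A w *m u) i 0%R ^+ 2 / (6 * tau ^+ 2))%R.
  by rewrite divr_ge0 ?sqr_ge0 ?ltW.
have [_ iq] := integrable_of_expR (measurable_row_sqr u i _) q0 H.
have := integrableZl measurableT (6 * tau ^+ 2)%R iq.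
apply: eq_integrable => // w _ /=; rewrite -EFinM; congr (_%:E).
by field; rewrite gt_eqF.
Qed.

Lemma integrable_entry_mul i j j' : P.-integrable setT (fun w => (A w i j * A w i j')%:E).
Proof.
have sq k : P.-integrable setT (fun w => (A w i k ^+ 2)%:E).
  have e1 : l2norm (delta_mx k 0%R : 'cV[R]_m) = 1%R.
    rewrite /l2norm (bigD1 k)//= big1 ?addr0 ?mxE ?eqxx ?expr1n ?sqrtr1//.
    by move=> l /negPf lk; rewrite mxE lk expr0n.
  have := integrable_row_sqr i e1; apply: eq_integrable => // w _.
  by rewrite -colE mxE.
have /= := integrableD measurableT (sq j) (sq j'); apply: le_integrable => //.
  apply/measurable_EFinP; apply: measurable_funM; exact: measurable_sub_gaussian_entry.
move=> w _; rewrite /= lee_fin [leRHS]ger0_norm ?addr_ge0 ?sqr_ge0// normrM.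
have := sqr_ge0 (`|A w i j| - `|A w i j'|)%R.
rewrite -(real_normK (num_real (A w i j))) -(real_normK (num_real (A w i j'))).
have := normr_ge0 (A w i j); have := normr_ge0 (A w i j').
move: `|A w i j|%R `|A w i j'|%R => a b; nra.
Qed.

(** The second moment is the covariance form since the entries are centred; the
    products of entries are integrable because squares have exponential
    moments. *)
Lemma row_second_moment u i :
  \int[P]_w ((A w *m u) i 0%R ^+ 2)%:E = (quad_form Sigma u)%:E.
Proof.
have [_ zA cA _] := subA.
have E w : ((A w *m u) i 0%R ^+ 2)%:E =
    \sum_j \sum_j' (u j 0%R * u j' 0%R)%:E * (A w i j * A w i j')%:E.
  rewrite expr2 mxE mulr_suml -sumEFin; apply: eq_bigr => j _.
  rewrite mulr_sumr -sumEFin; apply: eq_bigr => j' _.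
  by rewrite -EFinM; congr (_%:E); ring.
have iT j j' : P.-integrable setT (fun w => (u j 0%R * u j' 0%R)%:E * (A w i j * A w i j')%:E).
  exact: integrableZl (integrable_entry_mul i j j').
under eq_integral do rewrite E.
rewrite integral_sum//; last by move=> j; apply: integrable_sum.
rewrite quad_formE dotE -sumEFin; apply: eq_bigr => j _.
rewrite integral_sum// mxE mulr_sumr -sumEFin; apply: eq_bigr => j' _.
rewrite integralZl//; last exact: integrable_entry_mul.
have := cA i j j'; rewrite covariance.unlock (zA i j).2 (zA i j').2 /= unlock => cov.
rewrite (_ : \int[P]_w (A w i j * A w i j')%:E = (Sigma j j')%:E).
  by rewrite -EFinM; congr (_%:E); ring.
rewrite -cov; apply: eq_integral => w _ /=.
by rewrite !fctE /= !subr0.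
Qed.

(** Chernoff's bound at parameter 1 / (6 tau^2): the exponential moments
    contribute 4 n and the threshold 30 / 6 n = 5 n. *)
Lemma sum_row_sqr_large u (tau : R) : l2norm u = 1%R -> (0 < tau)%R -> (s2 <= tau ^+ 2)%R ->
  P [set w | 30 * tau ^+ 2 * n%:R <= dot (A w *m u) (A w *m u)]%R <= (expR (- n%:R))%:E.
Proof.
move=> u1 t0 st; have [[mX indX _] _ _ _] := subA.
pose h (x : m.-tuple R) := (tuple_dot u x ^+ 2 / (6 * tau ^+ 2))%R.
have mh : measurable_fun setT h.
  by apply: measurable_funM => //; apply: measurable_funX; exact: measurable_tuple_dot.
have c0 : (0 < 6 * tau ^+ 2)%R by rewrite mulr_gt0 ?exprn_gt0.
have := @chernoff_sum _ _ _ _ _ P n rows mX indX h (5 * n%:R)%R 4 mh _.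
have -> : (n%:R * 4 - 5 * n%:R = - n%:R :> R)%R by ring.
have -> : [set w | 5 * n%:R <= \sum_(i < n) h (rows i w)]%R =
   [set w | 30 * tau ^+ 2 * n%:R <= dot (A w *m u) (A w *m u)]%R.
  apply/seteqP; split => w /=; rewrite dotvv -mulr_suml.
    under eq_bigr do rewrite tuple_dot_row.
    by rewrite ler_pdivlMr//; congr (_ <= _)%R; ring.
  under [in X in _ -> X]eq_bigr do rewrite tuple_dot_row.
  by rewrite ler_pdivlMr//; congr (_ <= _)%R; ring.
apply; move=> i.
under eq_integral do rewrite /h tuple_dot_row.
exact: row_expR_sqr_le.
Qed.

(** Chernoff's bound for the centred squares divided by 6 tau^2, with the
    parameter x / (16 exp 4) optimal in - t n x + 8 exp(4) t^2 n; the sign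
    (-1)^b treats both tails. *)
Lemma sum_row_sqr_deviation u (tau x : R) (b : bool) :
  l2norm u = 1%R -> (0 < tau)%R -> (s2 <= tau ^+ 2)%R -> (0 < x <= 1)%R ->
  P [set w | 6 * tau ^+ 2 * n%:R * x <=
      (-1) ^+ b * (dot (A w *m u) (A w *m u) - n%:R * quad_form Sigma u)]%R
    <= (expR (- (n%:R * x ^+ 2 / (32 * expR 4))))%:E.
Proof.
move=> u1 t0 st /andP[x0 x1]; have [[mX indX _] _ _ _] := subA.
have c0 : (0 < 6 * tau ^+ 2)%R by rewrite mulr_gt0 ?exprn_gt0.
have e4 : (1 <= expR 4 :> R)%R by have := expR_ge1Dx (4 : R); lra.
have e40 : (0 < expR 4 :> R)%R := expR_gt0 _.
pose th := ((-1) ^+ b * (x / (16 * expR 4)))%R : R.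
pose v := (quad_form Sigma u / (6 * tau ^+ 2))%R.
pose h (y : m.-tuple R) := (th * (tuple_dot u y ^+ 2 / (6 * tau ^+ 2) - v))%R.
have mh : measurable_fun setT h.
  apply: measurable_funM => //; apply: measurable_funB => //.
  by apply: measurable_funM => //; apply: measurable_funX; exact: measurable_tuple_dot.
have := @chernoff_sum _ _ _ _ _ P n rows mX indX h (n%:R * x ^+ 2 / (16 * expR 4))%R
  (8 * expR 4 * th ^+ 2)%R mh _.
have -> : (n%:R * (8 * expR 4 * th ^+ 2) - n%:R * x ^+ 2 / (16 * expR 4) =
   - (n%:R * x ^+ 2 / (32 * expR 4)) :> R)%R.
  rewrite /th exprMn sqrr_sign; field; lra.
set S := (X in _ -> P X <= _).
have -> : [set w | n%:R * x ^+ 2 / (16 * expR 4) <= \sum_(i < n) h (rows i w)]%R = S.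
  have hE w : (\sum_(i < n) h (rows i w) = (x / (16 * expR 4) / (6 * tau ^+ 2)) *
      ((-1) ^+ b * (dot (A w *m u) (A w *m u) - n%:R * quad_form Sigma u)))%R.
    rewrite -mulr_sumr sumrB sumr_const card_ord dotvv.
    under eq_bigr do rewrite tuple_dot_row.
    rewrite -mulr_suml /th /v -mulr_natl; field; rewrite ?gt_eqF//.
  have aE : (n%:R * x ^+ 2 / (16 * expR 4) = (x / (16 * expR 4) / (6 * tau ^+ 2)) *
      (6 * tau ^+ 2 * n%:R * x) :> R)%R.
    by field; rewrite !gt_eqF.
  have k0 : (0 < x / (16 * expR 4) / (6 * tau ^+ 2))%R by rewrite !divr_gt0// mulr_gt0.
  by apply/seteqP; split => w /=; rewrite hE aE ler_pM2l.
apply; move=> i.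
have q0 w : (0 <= (A w *m u) i 0%R ^+ 2 / (6 * tau ^+ 2))%R.
  by rewrite divr_ge0 ?sqr_ge0 ?ltW.
have H := row_expR_sqr_le i u1 t0 st.
have th2 : (`|th| <= 1 / 2)%R.
  have xe : (0 <= x / (16 * expR 4))%R by rewrite divr_ge0 ?ltW ?mulr_gt0.
  rewrite /th normrM normr_sign ger0_norm// !mul1r.
  by rewrite ler_pdivrMr ?mulr_gt0//; lra.
have := centered_mgf_le (measurable_row_sqr u i _) q0 H th2.
have -> : fine (\int[P]_w ((A w *m u) i 0%R ^+ 2 / (6 * tau ^+ 2))%:E) = v.
  under eq_integral do rewrite mulrC.
  rewrite ge0_integral_EFinZl.
  - by rewrite row_second_moment /= mulrC.
  - by rewrite invr_ge0 ltW.
  - by apply: measurable_funX; exact: measurable_sub_gaussian_row.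
  - by move=> w; exact: sqr_ge0.
by under [in X in _ -> X]eq_integral do rewrite /h tuple_dot_row.
Qed.

End sub_gaussian_rows.

Section union_bound.
Context d (T : measurableType d) (R : realType) (P : probability T R).
Local Open Scope ereal_scope.

Lemma le_probability (A B : set T) : measurable A -> measurable B ->
  A `<=` B -> P A <= P B.
Proof. by move=> mA mB; apply: le_measure; exact: mem_set. Qed.

(** Events are only combined through their measurable intersections, since a
    measure says nothing of nonmeasurable sets. *)
Lemma probability_setI_ge (A B : set T) (a b : R) : measurable A -> measurable B ->
  (1 - a)%:E <= P A -> (1 - b)%:E <= P B -> (1 - (a + b))%:E <= P (A `&` B).
Proof.
move=> mA mB Pa Pb.
have : P A <= P (A `&` B) + b%:E.
  apply: (@le_trans _ _ (P (A `&` B) + P (~` B))).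
    apply: le_trans (measureU2 _ _ _) => //; last 2 first.
    - exact: measurableI.
    - exact: measurableC.
    apply: le_probability => //.
      by apply: measurableU; [exact: measurableI | exact: measurableC].
    by move=> w Aw; have [Bw|nB] := pselect (B w); [left|right].
  apply: leeD => //; rewrite probability_setC//.
  by rewrite leeBlDr ?fin_num_measure// -leeBlDl.
move=> h; rewrite opprD addrA EFinB leeBlDr//.
exact: le_trans h.
Qed.

Lemma probability_forall_ge (F : finType) (B : F -> set T) (e : R) :
  (forall f, measurable (B f)) -> (forall f, P (B f) <= e%:E) ->
  exists2 E, measurable E & (1 - #|F|%:R * e)%:E <= P E /\
    forall w, E w -> forall f, ~ B f w.
Proof.
move=> mB Be.
suff [E mE [PE EB]] : exists2 E, measurable E &
    (1 - (size (enum F))%:R * e)%:E <= P E /\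
    forall w, E w -> forall f, f \in enum F -> ~ B f w.
  by rewrite -cardE in PE; exists E => //; split => // w /EB h f; apply: h; rewrite mem_enum.
elim: (enum F) => [|f s [E mE [PE EB]]].
  by exists setT => //; rewrite mul0r subr0 probability_setT.
exists (~` B f `&` E); first by apply: measurableI => //; exact: measurableC.
split.
  have -> : ((size (f :: s))%:R * e = e + (size s)%:R * e)%R.
    by rewrite /= -natr1; ring.
  apply: probability_setI_ge => //.
    exact: measurableC.
  by rewrite probability_setC// EFinB leeB.
move=> w [nB Ew] g; rewrite inE => /predU1P[->//|]; exact: EB.
Qed.

End union_bound.

Section strict_tail.
Context d (T : measurableType d) (R : realType) (P : probability T R)
  (n m : nat) (A : T -> 'M[R]_(n, m)) (Sigma : 'M[R]_m) (s : R).
Hypothesis subA : sub_gaussian_mx P A Sigma (s ^+ 2).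
Hypothesis n0 : (0 < n)%N.
Hypothesis s0 : 0 <= s.

Lemma measurable_dot_row (u : 'cV[R]_m) : measurable_fun setT (fun w => dot (A w *m u) (A w *m u)).
Proof.
by apply: measurable_dot => i; exact: measurable_sub_gaussian_row subA _ _.
Qed.

(** A variance parameter s = 0 is allowed: the event is then the increasing union
    of the events for the positive parameters 1 / (k + 1), each of which has
    probability at most exp(- n). *)
Lemma sum_row_sqr_tail (u : 'cV[R]_m) : l2norm u = 1 ->
  (P [set w | (30 * s ^+ 2 * n%:R < dot (A w *m u) (A w *m u))%R] <= (expR (- n%:R))%:E)%E.
Proof.
move=> u1; pose f w := dot (A w *m u) (A w *m u).
have mge c : measurable [set w | c <= f w] := measurable_ge c (measurable_dot_row u).
have mgt c : measurable [set w | c < f w] := measurable_gt c (measurable_dot_row u).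
have [sp|] := ltrP 0 s.
  apply: le_trans (sum_row_sqr_large subA u1 sp (lexx _)).
  by apply: le_probability => // w /ltW.
move=> s0'; have {s0'}se : s = 0 by apply/eqP; rewrite eq_le s0 s0'.
rewrite se expr0n /= mulr0 mul0r.
pose F k := [set w | 30 * (k.+1%:R^-1) ^+ 2 * n%:R <= f w].
have FE : [set w | 0 < f w] = \bigcup_k F k.
  apply/seteqP; split => w /=.
    move=> fw; pose k := Num.trunc (30 * n%:R / f w); exists k => //.
    rewrite /F /=.
    have k1 : 30 * n%:R / f w < k.+1%:R by exact: truncnS_gt.
    have k2 : 1 <= k.+1%:R :> R by rewrite ler1n.
    have k0 : 0 < k.+1%:R :> R by [].
    rewrite ltr_pdivrMr// in k1.
    have -> : 30 * k.+1%:R^-1 ^+ 2 * n%:R = (30 * n%:R) / k.+1%:R ^+ 2 :> R.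
      by field; rewrite gt_eqF.
    rewrite ler_pdivrMr ?exprn_gt0//; apply: (le_trans (ltW k1)).
    have -> : f w * k.+1%:R ^+ 2 = k.+1%:R * (k.+1%:R * f w) by ring.
    by rewrite ler_peMl// mulr_ge0// ltW.
  by case=> k _ /=; apply: lt_le_trans; rewrite !mulr_gt0 ?exprn_gt0 ?invr_gt0 ?ltr0n.
have mF k : measurable (F k) by exact: mge.
have ndF : {homo F : a b / (a <= b)%N >-> (a <= b)%O}.
  move=> a b ab; apply/subsetPset => w; rewrite /F /=; apply: le_trans.
  rewrite ler_wpM2r// ler_wpM2l// lerXn2r ?nnegrE ?invr_ge0//.
  by rewrite lef_pV2 ?posrE// ler_nat ltnS.
rewrite FE.
have cvg := @nondecreasing_cvg_mu _ _ _ P F mF (bigcupT_measurable _ mF) ndF.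
apply: (cvge_to_le cvg); near=> k => /=.
have ksp : (0 : R) < k.+1%:R^-1 by rewrite invr_gt0.
have st : s ^+ 2 <= (k.+1%:R^-1 : R) ^+ 2 by rewrite se expr0n /= sqr_ge0.
exact: (sum_row_sqr_large subA u1 ksp st).
Unshelve. all: by end_near. Qed.

End strict_tail.

(** * Uniform bounds for random quadratic forms *)

Lemma mdot_delta (R : pzRingType) (p q : nat) (i : 'I_p) (j : 'I_q) :
  mdot (delta_mx i j) (delta_mx i j) = 1 :> R.
Proof.
rewrite /mdot (bigD1 i)//= (bigD1 j)//= !mxE !eqxx mulr1 !big1 ?addr0//.
  by move=> k ki; apply: big1 => l _; rewrite !mxE (negPf ki) mul0r.
by move=> l lj; rewrite !mxE (negPf lj) andbF mul0r.
Qed.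

Lemma mdotC (R : comPzRingType) (p q : nat) (U V : 'M[R]_(p, q)) : mdot U V = mdot V U.
Proof. by apply: eq_bigr => i _; apply: eq_bigr => j _; rewrite mulrC. Qed.

Lemma mdot_linear (R : comPzRingType) (p q : nat) (a : R) (U V W : 'M[R]_(p, q)) :
  mdot (a *: U + V) W = a * mdot U W + mdot V W.
Proof.
rewrite /mdot mulr_sumr -big_split /=; apply: eq_bigr => i _.
rewrite mulr_sumr -big_split /=; apply: eq_bigr => j _.
by rewrite !mxE mulrDl mulrA.
Qed.

Lemma mdot_col (R : realType) (p : nat) (u v : 'cV[R]_p) : mdot u v = dot u v.
Proof. by rewrite dotE; apply: eq_bigr => i _; rewrite big_ord1. Qed.

Lemma l1mx_col (R : realType) (p : nat) (u : 'cV[R]_p) : l1mx u = l1norm u.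
Proof. by apply: eq_bigr => i _; rewrite big_ord1. Qed.

Lemma atom_sum_support (R : pzRingType) (p q : nat) (t : seq ('I_p * 'I_q * bool))
    (U : 'M[R]_(p, q)) i j :
  (forall x, x \in t -> U x.1.1 x.1.2 != 0) -> atom_sum R t i j != 0 -> U i j != 0.
Proof.
move=> H; apply: contraNneq => Uij; apply/eqP; rewrite /atom_sum summxE big_seq.
apply: big1 => x xt; rewrite !mxE.
case: eqP => [ix|_]; case: eqP => [jx|_]; rewrite ?mulr0//.
by have := H x xt; rewrite -ix -jx Uij eqxx.
Qed.

Lemma atom_sum_nseq (R : pzRingType) (p q m : nat) (i : 'I_p) (j : 'I_q) :
  atom_sum R (nseq m (i, j, false)) = m%:R *: delta_mx i j.
Proof.
rewrite /atom_sum big_nseq /= expr0 scale1r.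
by elim: m => [|m IH]; rewrite ?scale0r//= IH -natr1 scalerDl scale1r addrC.
Qed.

Section uniform_upper_bound.
Context d (T : measurableType d) (R : realType) (P : probability T R)
  (n a b m : nat) (A : T -> 'M[R]_(a, b) -> 'cV[R]_n) (adm : pred 'M[R]_(a, b))
  (K e : R).
Hypothesis linA : forall w c U V, A w (c *: U + V) = c *: A w U + A w V.
Hypothesis admS : forall U V : 'M[R]_(a, b), adm U -> (forall i j, V i j != 0 -> U i j != 0) -> adm V.
Hypothesis mA : forall U, measurable_fun setT (fun w => dot (A w U) (A w U)).
Hypothesis tailA : forall U, adm U ->
  (P [set w | (K * mdot U U < dot (A w U) (A w U))%R] <= e%:E)%E.
Hypothesis e0 : 0 <= e.
Hypothesis K0 : 0 <= K.
Hypothesis m1 : (1 < m)%N.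

(** maurey_quadratic_le for the form |A U|^2 - K |U|^2, which is at least - K at
    elementary matrices. Only admissible test matrices are required to satisfy
    the tail bound, adm being the sparsity constraint on the columns. *)
Lemma uniform_upper_bound : exists2 E, measurable E &
  ((1 - ((a * b * 2) ^ m)%:R * e)%:E <= P E)%E /\
  forall w, E w -> forall U, adm U ->
    dot (A w U) (A w U) <= K * (mdot U U + 2 / m%:R * l1mx U ^+ 2).
Proof.
pose F := (m.-tuple ('I_a * 'I_b * bool))%type.
pose Bad (t : F) : set T := if adm (atom_sum R t) then
  [set w | (K * mdot (atom_sum R t) (atom_sum R t) < dot (A w (atom_sum R t)) (A w (atom_sum R t)))%R]
  else set0.
have mBad t : measurable (Bad t).
  by rewrite /Bad; case: ifP => // _; exact: measurable_gt.
have Pbad t : (P (Bad t) <= e%:E)%E.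
  by rewrite /Bad; case: ifP => [/tailA//|_]; rewrite measure0 lee_fin.
have [E mE [PE EB]] := probability_forall_ge mBad Pbad.
exists E => //; split.
  by move: PE; rewrite card_tuple !card_prod !card_ord card_bool.
move=> w Ew U admU.
pose B (U V : 'M[R]_(a, b)) := dot (A w U) (A w V) - K * mdot U V.
have : B U U <= 2 * K / m%:R * l1mx U ^+ 2.
  apply: maurey_quadratic_le => //.
  - by move=> u v; rewrite /B dotC mdotC.
  - by move=> c u v z; rewrite /B linA dotDl dotZl mdot_linear; ring.
  - move=> t ht; have := EB w Ew t; rewrite /Bad.
    have -> : adm (atom_sum R t).
      by apply: admS admU _ => i j; exact: atom_sum_support.
    by move=> /= /negP; rewrite -leNgt /B subr_le0.
  - move=> i j; rewrite /B mdot_delta mulr1; have := dot_ge0 (A w (delta_mx i j)); lra.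
by rewrite /B lerBlDl => /le_trans; apply; rewrite mulrDr; apply: le_of_eq; ring.
Qed.

End uniform_upper_bound.

Section uniform_lower_bound.
Context d (T : measurableType d) (R : realType) (P : probability T R)
  (n p m : nat) (A : T -> 'M[R]_(n, p)) (Sigma : 'M[R]_p) (tau x : R).
Hypothesis subA : sub_gaussian_mx P A Sigma (tau ^+ 2).
Hypothesis symS : Sigma^T = Sigma.
Hypothesis tau0 : 0 < tau.
Hypothesis x01 : 0 < x <= 1.
Hypothesis m1 : (1 < m)%N.

(** maurey_quadratic_le for n v^T Sigma v - |A v|^2 - D |v|^2 with
    D = 6 tau^2 n x. One tail makes the form nonpositive at the test vectors, the other
    bounds it below by - 2 D at basis vectors, which are multiples of test
    vectors. Keeping the deviation relative to D, rather than to tau^2, gives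
    the l1 term a coefficient of the size of the deviation. *)
Lemma uniform_lower_bound : exists2 E, measurable E &
  ((1 - ((p * 2) ^ m)%:R * (2 * expR (- (n%:R * x ^+ 2 / (32 * expR 4)))))%:E <= P E)%E /\
  forall w, E w -> forall v : 'cV[R]_p,
    n%:R * (quad_form Sigma v - 6 * tau ^+ 2 * x * (dot v v + 4 / m%:R * l1norm v ^+ 2))
    <= dot (A w *m v) (A w *m v).
Proof.
have /andP[x0 x1] := x01.
pose D := 6 * tau ^+ 2 * n%:R * x.
have D0 : 0 <= D by rewrite !mulr_ge0 ?sqr_ge0// ltW.
pose F := (m.-tuple ('I_p * 'I_1 * bool) * bool)%type.
pose nrm (V : 'cV[R]_p) := (l2norm V)^-1 *: V.
pose dev w (u : 'cV[R]_p) := dot (A w *m u) (A w *m u) - n%:R * quad_form Sigma u.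
pose Bad (f : F) : set T := if atom_sum R f.1 == 0 then set0 else
  [set w | D <= (-1) ^+ f.2 * dev w (nrm (atom_sum R f.1))].
have mBad t : measurable (Bad t).
  rewrite /Bad; case: ifP => // _; apply: measurable_ge; apply: measurable_funM => //.
  by apply: measurable_funB => //; exact: measurable_dot_row subA _.
have nrm1 V : V != 0 -> l2norm (nrm V) = 1.
  move=> V0; rewrite l2normZ ger0_norm ?invr_ge0 ?l2norm_ge0// mulVf//.
  by rewrite l2norm_eq0.
have Pbad t : (P (Bad t) <= (expR (- (n%:R * x ^+ 2 / (32 * expR 4))))%:E)%E.
  rewrite /Bad; case: ifPn => [_|V0]; first by rewrite measure0 lee_fin expR_ge0.
  exact: (sum_row_sqr_deviation subA t.2 (nrm1 _ V0) tau0 (lexx _) x01).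
have [E mE [PE EB]] := probability_forall_ge mBad Pbad.
exists E => //; split.
  move: PE; rewrite card_prod card_tuple !card_prod !card_ord card_bool muln1.
  by rewrite natrM -mulrA.
move=> w Ew v.
have devZ (c : R) (u : 'cV[R]_p) : dev w (c *: u) = c ^+ 2 * dev w u.
  rewrite /dev -scalemxAr dotZl dotC dotZl !quad_formE -scalemxAr dotZl (dotC u) dotZl.
  by rewrite (dotC u); ring.
have devB (t : m.-tuple ('I_p * 'I_1 * bool)) (b : bool) :
    (-1) ^+ b * dev w (atom_sum R t) <= D * dot (atom_sum R t) (atom_sum R t).
  have [->|V0] := eqVneq (atom_sum R t) 0.
    by rewrite /dev mulmx0 quad_formE !dot0l !mulr0 subr0 mulr0.
  have := EB w Ew (t, b); rewrite /Bad /= (negPf V0) => /negP; rewrite -ltNge => /ltW.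
  rewrite devZ => h; rewrite -l2norm_sqr.
  have V0' : 0 < l2norm (atom_sum R t) by rewrite lt_def l2norm_ge0 l2norm_eq0 V0.
  rewrite -ler_pdivrMr ?exprn_gt0//; apply: le_trans h; apply: le_of_eq.
  by field; rewrite gt_eqF.
pose B (U V : 'cV[R]_p) := n%:R * dot U (Sigma *m V) - dot (A w *m U) (A w *m V) - D * mdot U V.
have : B v v <= 2 * (2 * D) / m%:R * l1mx v ^+ 2.
  apply: maurey_quadratic_le => //.
  - by move=> u z; rewrite /B (sym_dot u z symS) mdotC (dotC (A w *m u)).
  - move=> c u z y; rewrite /B mdot_linear mulmxDr -scalemxAr !dotDl !dotZl.
    by ring.
  - by rewrite mulr_ge0.
  - move=> t _; have := devB t true; rewrite expr1 mulN1r /dev /B mdot_col quad_formE.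
    by rewrite opprB; lra.
  - move=> i j.
    (* m copies of one atom form the test vector m times a basis vector *)
    have st : size (nseq m (i, j, false)) == m by rewrite size_nseq.
    have := devB (Tuple st) false; rewrite expr0 mul1r /= atom_sum_nseq devZ.
    rewrite dotZl dotC dotZl -mdot_col mdot_delta => h.
    have m0 : (0 : R) < m%:R by rewrite ltr0n ltnW.
    have {h} : m%:R ^+ 2 * dev w (delta_mx i j) <= m%:R ^+ 2 * D.
      by apply: le_trans h _; apply: le_of_eq; ring.
    rewrite ler_pM2l ?exprn_gt0// /dev /B mdot_delta quad_formE; lra.
rewrite /B mdot_col -quad_formE l1mx_col.
rewrite -subr_ge0 => h; rewrite -subr_ge0; apply: le_trans h _; apply: le_of_eq.
by rewrite /D; ring.
Qed.

End uniform_lower_bound.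

(** * Rational directions and products of the instruments *)

Section rational_vectors.
Context (R : realType) (p : nat).

Lemma rational_approximation (v : 'cV[R]_p) : exists q : nat -> 'cV[rat]_p,
  forall i, (ratr (q k i 0) : R) @[k --> \oo] --> v i 0.
Proof.
have /choice[q Hq] : forall k : nat, exists q : 'cV[rat]_p, forall i,
    v i 0 <= ratr (q i 0) <= v i 0 + harmonic k.
  move=> k; have /choice[f Hf] : forall i, exists x : rat, v i 0 <= ratr x <= v i 0 + harmonic k.
    move=> i; have lt : v i 0 < v i 0 + harmonic k by rewrite ltrDl harmonic_gt0.
    have [x] := rat_in_itvoo lt; rewrite in_itv /= => /andP[/ltW a /ltW b].
    by exists x; rewrite a b.
  by exists (\col_i f i) => i; rewrite mxE.
exists q => i.
apply: (@squeeze_cvgr _ _ _ _ (fun=> v i 0) (fun k => v i 0 + harmonic k)).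
- by near=> k; exact: Hq.
- exact: cvg_cst.
- rewrite -[X in _ --> X]addr0; apply: cvgD; [exact: cvg_cst | exact: cvg_harmonic].
Unshelve. all: by end_near. Qed.

Lemma cvg_sumr (I : Type) (s : seq I) (F : I -> nat -> R) (l : I -> R) :
  (forall i, F i k @[k --> \oo] --> l i) ->
  (\sum_(i <- s) F i k) @[k --> \oo] --> \sum_(i <- s) l i.
Proof. by move=> H; apply: cvg_big => // x; exact: add_continuous. Qed.

(** Both sides are continuous in v and rational vectors are dense. *)
Lemma forall_rational_quadratic (n : nat) (M : 'M[R]_(n, p)) (a b c : R) :
  (forall q : 'cV[rat]_p, let v := map_mx ratr q : 'cV[R]_p in
     a * dot v v - b * l1norm v ^+ 2 <= dot (M *m v) (M *m v) / c) ->
  forall v : 'cV[R]_p, a * dot v v - b * l1norm v ^+ 2 <= dot (M *m v) (M *m v) / c.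
Proof.
move=> H v; have [q Hq] := rational_approximation v.
pose u k : 'cV[R]_p := map_mx ratr (q k).
have cu i : u k i 0 @[k --> \oo] --> v i 0.
  by rewrite (_ : (fun k => _) = (fun k => ratr (q k i 0)))//; apply/funext => k; rewrite mxE.
have cdot (m : nat) (x : nat -> 'cV[R]_m) (y : 'cV[R]_m) :
    (forall i, x k i 0 @[k --> \oo] --> y i 0) -> dot (x k) (x k) @[k --> \oo] --> dot y y.
  move=> hx; rewrite dotE (_ : (fun k => _) = (fun k => \sum_i x k i 0 * x k i 0)).
    by apply: cvg_sumr => i; apply: cvgM.
  by apply/funext => k; rewrite dotE.
have cMu i : (M *m u k) i 0 @[k --> \oo] --> (M *m v) i 0.
  rewrite mxE (_ : (fun k => _) = (fun k => \sum_j M i j * u k j 0)).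
    by apply: cvg_sumr => j; apply: cvgM => //; exact: cvg_cst.
  by apply/funext => k; rewrite mxE.
have cl1 : l1norm (u k) @[k --> \oo] --> l1norm v.
  by apply: cvg_sumr => i; apply: cvg_norm.
have cl2 : l1norm (u k) ^+ 2 @[k --> \oo] --> l1norm v ^+ 2.
  rewrite expr2 (_ : (fun k => _) = (fun k => l1norm (u k) * l1norm (u k))); first exact: cvgM.
  by apply/funext => k; rewrite expr2.
have cc (x : R) : (fun _ : nat => x) @ \oo --> x by exact: cvg_cst.
have h1 := cvgB (cvgM (cc a) (cdot _ _ _ cu)) (cvgM (cc b) cl2).
have h2 := cvgM (cdot _ _ _ cMu) (cc c^-1).
apply: (ler_cvg_to (h1 _ _ _) (h2 _)).
by near=> k; exact: H.
Unshelve. all: by end_near. Qed.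

End rational_vectors.

Section stage_matrix.
Context (R : realType) (n p d : nat).
Implicit Types (Z : 'I_p -> 'M[R]_(n, d)) (U : 'M[R]_(d, p)).

Definition stage_apply Z U : 'cV[R]_n := \sum_j Z j *m col j U.

Lemma stage_apply_linear Z c U V :
  stage_apply Z (c *: U + V) = c *: stage_apply Z U + stage_apply Z V.
Proof.
rewrite /stage_apply scaler_sumr -big_split /=; apply: eq_bigr => j _.
by rewrite linearP /= mulmxDr -scalemxAr.
Qed.

Lemma stage_mx_mul Z (v : 'I_p -> 'cV[R]_d) (u : 'cV[R]_p) :
  stage_mx Z v *m u = stage_apply Z (\matrix_(l, j) (u j 0 * v j l 0)).
Proof.
apply/matrixP => i k; rewrite ord1 mxE summxE; apply: eq_bigr => j _.
rewrite !mxE mulr_suml; apply: eq_bigr => l _; rewrite !mxE; ring.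
Qed.

Lemma mdot_cols U : mdot U U = \sum_j dot (col j U) (col j U).
Proof.
rewrite /mdot exchange_big /=; apply: eq_bigr => j _.
by rewrite dotE; apply: eq_bigr => l _; rewrite !mxE.
Qed.

Definition col_sparse (k : nat) : pred 'M[R]_(d, p) :=
  fun U => [forall j, (l0norm (col j U) <= k)%N].

Lemma col_sparseS k U (V : 'M[R]_(d, p)) : col_sparse k U -> (forall i j, V i j != 0 -> U i j != 0) ->
  col_sparse k V.
Proof.
move=> /forallP sU UV; apply/forallP => j; apply: leq_trans (sU j).
by apply: subset_leq_card; apply/fintype.subsetP => l; rewrite !inE !mxE; exact: UV.
Qed.

Lemma l0normZ_le k (c : R) (v : 'cV[R]_k) : (l0norm (c *: v) <= l0norm v)%N.
Proof.
apply: subset_leq_card; apply/fintype.subsetP => l; rewrite !inE !mxE.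
by apply: contra_neq => ->; rewrite mulr0.
Qed.

End stage_matrix.

Section stage_tail.
Context dd (T : measurableType dd) (R : realType) (P : probability T R)
  (n p d k : nat) (Z : 'I_p -> T -> 'M[R]_(n, d)) (s : R)
  (SigmaW : ('I_p -> 'cV[R]_d) -> 'M[R]_p).
Hypothesis n0 : (0 < n)%N.
Hypothesis s0 : 0 <= s.
Hypothesis mZ : forall j i l, measurable_fun setT (fun w => Z j w i l).
Hypothesis subW : forall v : 'I_p -> 'cV[R]_d, (forall j, sparse_ball k%:R (v j)) ->
  sub_gaussian_mx P (fun w => stage_mx (Z ^~ w) v) (SigmaW v) (s ^+ 2).

Lemma measurable_stage_apply U : measurable_fun setT
  (fun w => dot (stage_apply (Z ^~ w) U) (stage_apply (Z ^~ w) U)).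
Proof.
apply: measurable_dot => i.
rewrite (_ : (fun w => _) = (fun w => \sum_j \sum_l Z j w i l * U l j)); last first.
  apply/funext => w; rewrite summxE; apply: eq_bigr => j _.
  by rewrite mxE; apply: eq_bigr => l _; rewrite mxE.
apply: measurable_sum => j; apply: measurable_sum => l.
by apply: measurable_funM.
Qed.

(** Normalizing the columns of U writes Z U as a multiple of W u, where the
    columns of W are the Z_j v_j for sparse v_j of norm at most one and u is a
    unit vector, a direction covered by the sub-Gaussian hypothesis on W. *)
Lemma stage_apply_tail U : col_sparse k U ->
  (P [set w | (30 * s ^+ 2 * n%:R * mdot U U
     < dot (stage_apply (Z ^~ w) U) (stage_apply (Z ^~ w) U))%R] <= (expR (- n%:R))%:E)%E.
Proof.
move=> /forallP sU.
have [->|U0] := eqVneq U 0.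
  rewrite (_ : [set w | _] = set0) ?measure0 ?lee_fin ?expR_ge0//.
  apply/seteqP; split => w //=.
  have -> : stage_apply (Z ^~ w) 0 = 0 :> 'cV[R]_n.
    by rewrite /stage_apply big1// => j _; rewrite linear0 mulmx0.
  rewrite dot0l mdot_cols big1 ?mulr0 ?ltxx// => j _.
  by rewrite linear0 dot0l.
pose r := Num.sqrt (mdot U U).
have UU0 : 0 <= mdot U U by rewrite mdot_cols sumr_ge0// => j _; exact: dot_ge0.
have r2 : r ^+ 2 = mdot U U by rewrite sqr_sqrtr.
have r0 : r != 0.
  rewrite -sqrf_eq0 r2; apply: contra U0; rewrite mdot_cols psumr_eq0; last by move=> j _; exact: dot_ge0.
  move=> /allP H; apply/eqP/matrixP => l j; rewrite mxE.
  have := H j (mem_index_enum _); rewrite dot_eq0 => /eqP /matrixP/(_ l 0).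
  by rewrite !mxE.
pose v j := (l2norm (col j U))^-1 *: col j U.
pose u : 'cV[R]_p := \col_j (l2norm (col j U) / r).
have vb j : sparse_ball k%:R (v j).
  split; first by rewrite ler_nat; apply: leq_trans (sU j); exact: l0normZ_le.
  rewrite l2normZ ger0_norm ?invr_ge0 ?l2norm_ge0//.
  have [->|c0] := eqVneq (l2norm (col j U)) 0; first by rewrite mulr0 ler01.
  by rewrite mulVf.
have u1 : l2norm u = 1.
  apply/eqP; rewrite -sqrp_eq1 ?l2norm_ge0// l2norm_sqr dotvv.
  under eq_bigr do rewrite mxE expr_div_n l2norm_sqr.
  by rewrite -mulr_suml -mdot_cols r2 divff// -r2 sqrf_eq0.
have UE w : stage_apply (Z ^~ w) U = r *: (stage_mx (Z ^~ w) v *m u).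
  rewrite stage_mx_mul -[RHS]addr0 -[in RHS](_ : stage_apply (Z ^~ w) 0 = 0); last first.
    by rewrite /stage_apply big1// => j _; rewrite linear0 mulmx0.
  rewrite -stage_apply_linear addr0; congr stage_apply.
  apply/matrixP => l j; rewrite !mxE.
  have [c0|c0] := eqVneq (l2norm (col j U)) 0.
    rewrite c0 mul0r mul0r mulr0.
    by move/eqP: c0; rewrite l2norm_eq0 => /eqP/matrixP/(_ l 0); rewrite !mxE.
  by field; rewrite r0 c0.
have := sum_row_sqr_tail (subW vb) n0 s0 u1.
have r2p : 0 < r ^+ 2 by rewrite lt_def sqrf_eq0 r0 sqr_ge0.
congr (P _ <= _)%E; apply/funext => w; apply/propext => /=.
by rewrite UE dotZl dotC dotZl -r2 mulrA -expr2 (mulrC _ (r ^+ 2)) ltr_pM2l.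
Qed.

End stage_tail.

(** * Perturbation by the first-stage errors *)

Section perturbation.
Context (R : realType).

Lemma l1norm_sqr_le (k m : nat) (x : 'cV[R]_m) : (l0norm x <= k)%N ->
  l1norm x ^+ 2 <= k%:R * dot x x.
Proof.
move=> xk; pose y : 'cV[R]_m := \col_i `|x i 0|.
pose z : 'cV[R]_m := \col_i (i \in supp x)%:R.
have <- : dot y z = l1norm x.
  rewrite dotE; apply: eq_bigr => i _; rewrite !mxE inE.
  by case: eqP => [->|_]; rewrite ?normr0 ?mul0r ?mulr1.
have yy : dot y y = dot x x.
  by rewrite !dotvv; apply: eq_bigr => i _; rewrite mxE real_normK ?num_real.
have zz : dot z z = (l0norm x)%:R.
  rewrite dotvv /l0norm -sum1_card natr_sum [RHS]big_mkcond /=; apply: eq_bigr => i _.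
  by rewrite mxE; case: (i \in supp x); rewrite ?expr1n ?expr0n.
apply: le_trans (sqr_dot_le y z) _; rewrite yy zz mulrC.
by apply: ler_wpM2r; [exact: dot_ge0 | rewrite ler_nat].
Qed.

(** Cauchy-Schwarz for the cross term; the square of y is dropped. *)
Lemma dot_perturbation_ge (n : nat) (x y : 'cV[R]_n) (B c e : R) : 0 <= c -> 0 <= e ->
  B <= dot x x -> dot x x <= c ^+ 2 -> dot y y <= e ^+ 2 ->
  B - 2 * c * e <= dot (x + y) (x + y).
Proof.
move=> c0 e0 Bx xc ye; rewrite dotDl !(dotC _ (x + y)) !dotDl (dotC y x).
have : `|dot x y| <= c * e.
  rewrite -(ler_pXn2r (n := 2))// ?nnegrE ?mulr_ge0// real_normK ?num_real//.
  by rewrite exprMn; apply: le_trans (sqr_dot_le _ _) _; apply: ler_pM => //; exact: dot_ge0.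
rewrite ler_norml => /andP[h _]; have := dot_ge0 y; lra.
Qed.

Definition scaled_columns (p d : nat) (D : 'I_p -> 'cV[R]_d) (v : 'cV[R]_p) : 'M[R]_(d, p) :=
  \matrix_(l, j) (v j 0 * D j l 0).

Lemma col_scaled_columns p d (D : 'I_p -> 'cV[R]_d) (v : 'cV[R]_p) j :
  col j (scaled_columns D v) = v j 0 *: D j.
Proof. by apply/matrixP => l i; rewrite !mxE ord1. Qed.

Lemma mdot_scaled_columns_le p d (D : 'I_p -> 'cV[R]_d) (v : 'cV[R]_p) (e : R) :
  (forall j, l2norm (D j) <= e) ->
  mdot (scaled_columns D v) (scaled_columns D v) <= e ^+ 2 * dot v v.
Proof.
move=> De; rewrite mdot_cols dotvv mulr_sumr; apply: ler_sum => j _.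
rewrite col_scaled_columns dotZl dotC dotZl -l2norm_sqr mulrA -expr2 mulrC.
apply: ler_wpM2r; first exact: sqr_ge0.
by rewrite lerXn2r ?nnegrE ?l2norm_ge0// (le_trans _ (De j))// l2norm_ge0.
Qed.

Lemma l1mx_scaled_columns_le p d k (D : 'I_p -> 'cV[R]_d) (v : 'cV[R]_p) (e : R) :
  (forall j, (l0norm (D j) <= k)%N) -> (forall j, l2norm (D j) <= e) -> 0 <= e ->
  l1mx (scaled_columns D v) ^+ 2 <= k%:R * e ^+ 2 * l1norm v ^+ 2.
Proof.
move=> Dk De e0.
have h : l1mx (scaled_columns D v) <= Num.sqrt k%:R * e * l1norm v.
  rewrite /l1mx exchange_big /= /l1norm mulr_sumr; apply: ler_sum => j _.
  have -> : \sum_i `|scaled_columns D v i j| = `|v j 0| * l1norm (D j).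
    by rewrite /l1norm mulr_sumr; apply: eq_bigr => i _; rewrite mxE normrM.
  rewrite mulrC ler_wpM2r//.
  have l0 : 0 <= l1norm (D j) by apply: sumr_ge0.
  rewrite -(ler_pXn2r (n := 2))// ?nnegrE ?mulr_ge0 ?sqrtr_ge0//.
  rewrite exprMn sqr_sqrtr//; apply: le_trans (l1norm_sqr_le (Dk j)) _.
  apply: ler_wpM2l => //; rewrite -l2norm_sqr.
  by rewrite lerXn2r ?nnegrE ?l2norm_ge0.
have l0 : 0 <= l1mx (scaled_columns D v) by apply: sumr_ge0 => i _; apply: sumr_ge0.
have -> : k%:R * e ^+ 2 * l1norm v ^+ 2 = (Num.sqrt k%:R * e * l1norm v) ^+ 2.
  by rewrite !exprMn sqr_sqrtr.
by rewrite lerXn2r ?nnegrE// (le_trans l0).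
Qed.

Lemma trunc_half_le (y : R) : 2 <= y ->
  [/\ (1 < Num.trunc y)%N, (Num.trunc y)%:R <= y & (Num.trunc y)%:R^-1 <= 2 / y].
Proof.
move=> y2; have y0 : 0 <= y by lra.
have /andP[t1 t2] := truncn_itv y0.
have m1 : (1 < Num.trunc y)%N by rewrite truncn_gt_nat.
split => //.
have m0 : 2 <= (Num.trunc y)%:R :> R by rewrite ler_nat.
rewrite -[_.+1%:R]natr1 in t2.
rewrite ler_pdivlMr; last by lra.
by rewrite mulrC ler_pdivrMr; lra.
Qed.

(** With M = max p d >= 2 one has d p 2 <= M^3. *)
Lemma atom_count_le (p d m : nat) (q : nat) : (0 < m)%N -> (1 < maxn p d)%N ->
  (q <= d * p * 2)%N ->
  (q ^ m)%:R <= expR (3 * m%:R * ln (maxn p d)%:R) :> R.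
Proof.
move=> m0 M1 qd; set M := maxn p d.
have M0 : (0 : R) < M%:R by rewrite ltr0n ltnW.
have -> : 3 * m%:R * ln M%:R = (3 * m)%:R * ln M%:R :> R by rewrite natrM.
rewrite expRM_natl lnK ?posrE// natrX exprM lerXn2r ?nnegrE ?exprn_ge0//.
rewrite -natrX ler_nat; apply: (leq_trans qd).
rewrite expnSr expnSr expn1 leq_mul// leq_mul ?leq_maxl ?leq_maxr//.
Qed.

End perturbation.

(** * Arithmetic of the rates *)

Section rate_arithmetic.
Context (R : realType).
Implicit Types a K r L N : R.

Lemma sqrt_rate_le K r L N : 1 <= K -> r <= 1 -> 0 <= L / N ->
  Num.sqrt (K * L / N) <= K `^ (3 / 2 - r) * Num.sqrt (L / N).
Proof.
move=> K1 r1 LN; rewrite -mulrA sqrtrM; last by lra.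
rewrite ler_wpM2r ?sqrtr_ge0//; rewrite -powR12_sqrt; last by lra.
by apply: ler_powR => //; lra.
Qed.

(** After squaring this is k^3 L / N <= k^(2 r) / a, which is the lower bound on
    the sample size. *)
Lemma sqrt_rate_mul_le a K r L N : 1 <= K -> 0 < a -> 0 < N -> 0 <= L ->
  a * (K `^ (3 - 2 * r) * L) <= N ->
  Num.sqrt (K * L / N) * K <= (Num.sqrt a)^-1 * K `^ r.
Proof.
move=> K1 a0 N0 L0 H; have K0 : 0 < K by lra.
have sa : 0 < Num.sqrt a by rewrite sqrtr_gt0.
rewrite -(ler_pXn2r (n := 2))// ?nnegrE ?mulr_ge0 ?sqrtr_ge0 ?powR_ge0 ?invr_ge0 ?(ltW K0) ?(ltW sa)//.
rewrite !exprMn sqr_sqrtr; last by rewrite divr_ge0 ?mulr_ge0 ?(ltW K0) ?(ltW N0).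
rewrite exprVn sqr_sqrtr ?(ltW a0)//.
have P : K `^ (3 - 2 * r) * (K `^ r) ^+ 2 = K ^+ 3.
  rewrite -powR_mulrn ?powR_ge0// -powRrM -powRD; last by rewrite (gt_eqF K0) implybT.
  by rewrite -powR_mulrn ?ltW//; congr (_ `^ _); ring.
have p0 : 0 < (K `^ r) ^+ 2 by rewrite exprn_gt0 ?powR_gt0.
rewrite ler_pdivlMl// mulrA -!mulrA.
have -> : a * (K * (L * (N^-1 * K ^+ 2))) = (a * (K ^+ 3 * L)) / N by field; rewrite gt_eqF.
rewrite ler_pdivrMr// -P mulrC -!mulrA.
have := ler_wpM2l (ltW p0) H; congr (_ <= _); ring.
Qed.

Lemma max_min_ratio (l s : R) : 0 < l -> 0 < s ->
  Num.max (s ^+ 4 / l ^+ 2) 1 * Num.min (l / s ^+ 2) 1 ^+ 2 = 1.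
Proof.
move=> l0 s0; have e4 : s ^+ 4 = (s ^+ 2) ^+ 2 by rewrite -exprM.
have [h|h] := leP (l / s ^+ 2) 1.
  rewrite max_l; first by field; rewrite !gt_eqF.
  rewrite ler_pdivlMr ?exprn_gt0// mul1r.
  rewrite ler_pdivrMr ?exprn_gt0// mul1r in h.
  by rewrite e4 lerXn2r ?nnegrE ?sqr_ge0// ltW.
rewrite max_r; first by rewrite expr1n mul1r.
rewrite ler_pdivrMr ?exprn_gt0// mul1r.
rewrite ltr_pdivlMr ?exprn_gt0// mul1r in h.
by rewrite e4 lerXn2r ?nnegrE ?sqr_ge0// ltW.
Qed.

(** The cross term is split: its l2 part goes to kappa2 by sqrt_rate_le, its l1
    part to kappa3 by sqrt_rate_mul_le. Here g stands for sigma_X sigma_W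
    sigma_eta / lamZ. *)
Lemma rate_bound a K r L N cA C b0 k2 k3 lam g v2 v1 :
  1 <= K -> r <= 1 -> 0 < a -> 0 < N -> 0 < L -> 0 < cA -> 0 <= C ->
  0 <= b0 -> 0 <= g -> g <= k2 -> g <= k3 -> b0 <= k3 -> 0 <= v2 -> 0 <= v1 ->
  a * (K `^ (3 - 2 * r) * L) <= N -> 0 <= r ->
  (lam - 60 * cA * k2 * K `^ (3 / 2 - r) * Num.sqrt (L / N)) * v2
    - (C + 960 * cA / Num.sqrt a) * k3 * (K `^ r * L / N) * v1
  <= lam * v2 - C * b0 * (L / N) * v1
     - 60 * (g * (cA * Num.sqrt (K * L / N))) * (v2 + 16 * K * (L / N) * v1).
Proof.
move=> K1 r1 a0 N0 L0 cA0 C0 b00 g0 gk2 gk3 bk3 v20 v10 H r0.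
have LN0 : 0 <= L / N by rewrite divr_ge0 ?ltW.
have h1 := sqrt_rate_le K1 r1 LN0.
have h2 := sqrt_rate_mul_le K1 a0 N0 (ltW L0) H.
have Kr : 1 <= K `^ r by rewrite -[leLHS](powRr0 K) ler_powR.
set S := Num.sqrt (K * L / N) in h1 h2 *; have S0 : 0 <= S by exact: sqrtr_ge0.
have sa : 0 < Num.sqrt a by rewrite sqrtr_gt0.
have k30 : 0 <= k3 by exact: le_trans gk3.
have A1 : g * (cA * S) * v2 <= cA * k2 * K `^ (3 / 2 - r) * Num.sqrt (L / N) * v2.
  apply: ler_wpM2r => //; rewrite mulrCA -!mulrA ler_pM2l//.
  by apply: ler_pM.
have A2 : C * b0 * (L / N) * v1 <= C * k3 * (K `^ r * L / N) * v1.
  apply: ler_wpM2r => //; apply: ler_pM => //; first by rewrite mulr_ge0.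
    by rewrite ler_wpM2l.
  by rewrite -mulrA ler_peMl.
have A3 : g * (cA * S) * (K * (L / N) * v1) <= cA / Num.sqrt a * k3 * (K `^ r * L / N) * v1.
  have -> : g * (cA * S) * (K * (L / N) * v1) = (g * (S * K)) * (cA * (L / N) * v1) by ring.
  have -> : cA / Num.sqrt a * k3 * (K `^ r * L / N) * v1
     = (k3 * ((Num.sqrt a)^-1 * K `^ r)) * (cA * (L / N) * v1) by ring.
  apply: ler_wpM2r; first by rewrite !mulr_ge0 ?invr_ge0 ?(ltW cA0) ?(ltW L0) ?(ltW N0).
  by apply: ler_pM => //; rewrite mulr_ge0//; lra.
set X1 := cA * k2 * _ * _ * v2 in A1; set Y1 := g * (cA * S) * v2 in A1.
set X2 := C * k3 * _ * v1 in A2; set Y2 := C * b0 * _ * v1 in A2.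
set X3 := cA / _ * k3 * _ * v1 in A3; set Y3 := g * (cA * S) * (_ * v1) in A3.
have -> : (lam - 60 * cA * k2 * K `^ (3 / 2 - r) * Num.sqrt (L / N)) * v2
    - (C + 960 * cA / Num.sqrt a) * k3 * (K `^ r * L / N) * v1
    = lam * v2 - 60 * X1 - X2 - 960 * X3 by rewrite /X1 /X2 /X3; ring.
have -> : 60 * (g * (cA * S)) * (v2 + 16 * K * (L / N) * v1) = 60 * Y1 + 960 * Y3.
  by rewrite /Y1 /Y3; ring.
rewrite -/Y2; move: A1 A2 A3; clearbody X1 X2 X3 Y1 Y2 Y3 => A1 A2 A3.
move: (lam * v2) => z; lra.
Qed.

End rate_arithmetic.

(** * First-stage events and the regular regime *)

Section design_matrix.
Context d (T : measurableType d) (R : realType) (P : probability T R)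
  (n m : nat) (A : T -> 'M[R]_(n, m)) (Sigma : 'M[R]_m) (s2 : R).
Hypothesis subA : sub_gaussian_mx P A Sigma s2.
Hypothesis n0 : (0 < n)%N.

Lemma covariance_matrix_sym : Sigma^T = Sigma.
Proof.
have [_ _ cA _] := subA; apply/matrixP => j j'; rewrite mxE; apply: EFin_inj.
by rewrite -(cA (Ordinal n0)) covarianceC cA.
Qed.

Lemma covariance_matrix_psd u : 0 <= quad_form Sigma u.
Proof.
rewrite -lee_fin -(row_second_moment subA u (Ordinal n0)).
by apply: integral_ge0 => w _; rewrite lee_fin sqr_ge0.
Qed.

Lemma column_tail (s : R) (u : 'cV[R]_m) : s2 = s ^+ 2 -> 0 <= s ->
  (P [set w | (30 * s ^+ 2 * n%:R * mdot u u < dot (A w *m u) (A w *m u))%R]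
    <= (expR (- n%:R))%:E)%E.
Proof.
move=> se s0; rewrite mdot_col; have [->|u0] := eqVneq u 0.
  rewrite (_ : [set w | _] = set0) ?measure0 ?lee_fin ?expR_ge0//.
  by apply/seteqP; split => w //=; rewrite mulmx0 !dot0l mulr0 ltxx.
have r0 : l2norm u != 0 by rewrite l2norm_eq0.
have r2p : 0 < l2norm u ^+ 2 by rewrite lt_def sqrf_eq0 r0 sqr_ge0.
pose v := (l2norm u)^-1 *: u.
have v1 : l2norm v = 1.
  by rewrite l2normZ ger0_norm ?invr_ge0 ?l2norm_ge0// mulVf.
have uE w : A w *m u = l2norm u *: (A w *m v).
  by rewrite scalemxAr scalerA divff// scale1r.
have subA' : sub_gaussian_mx P A Sigma (s ^+ 2) by rewrite -se.
have := sum_row_sqr_tail subA' n0 s0 v1.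
congr (P _ <= _)%E; apply/funext => w; apply/propext => /=.
rewrite -(l2norm_sqr u) uE dotZl dotC dotZl mulrA -expr2.
by rewrite (mulrC _ (l2norm u ^+ 2)) ltr_pM2l.
Qed.

End design_matrix.

Section first_stage_events.
Context dd (T : measurableType dd) (R : realType) (p d : nat)
  (pistar : 'I_p -> 'cV[R]_d) (pihat : 'I_p -> T -> 'cV[R]_d).
Hypothesis mpi : forall j k, measurable_fun setT (fun w => pihat j w k 0).

Lemma bigmax_l2norm_le (D : 'I_p -> 'cV[R]_d) (e : R) :
  \big[Num.max/0]_(j < p) l2norm (D j) <= e <-> 0 <= e /\ forall j, dot (D j) (D j) <= e ^+ 2.
Proof.
split => [/bigmax_leP[e0 H]|[e0 H]].
  split => // j; rewrite -l2norm_sqr lerXn2r ?nnegrE ?l2norm_ge0//; exact: H.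
apply/bigmax_leP; split => // j _; have := H j.
by rewrite -l2norm_sqr ler_pXn2r ?nnegrE ?l2norm_ge0.
Qed.

(** The maximum starts at 0, so the event is empty for negative e. *)
Lemma measurable_error_event (e : R) : measurable
  [set w | \big[Num.max/0]_(j < p) l2norm (pihat j w - pistar j) <= e].
Proof.
have [e0|e0] := leP 0 e; last first.
  rewrite (_ : [set w | _] = set0)//; apply/seteqP; split => w //=.
  by move=> /(bigmax_l2norm_le (fun j => pihat j w - pistar j)) []; rewrite leNgt e0.
rewrite (_ : [set w | _] = [set w | forall j,
    [set w | dot (pihat j w - pistar j) (pihat j w - pistar j) <= e ^+ 2] w]).
  apply: measurable_bigcap_countable => j; apply: measurable_le; apply: measurable_dot => k.
  rewrite (_ : (fun w => _) = (fun w => pihat j w k 0 - pistar j k 0)).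
    exact: measurable_funB.
  by apply/funext => w; rewrite !mxE.
apply/seteqP; split => w /=.
  by move=> /(bigmax_l2norm_le (fun j => pihat j w - pistar j)) [].
by move=> H; apply/(bigmax_l2norm_le (fun j => pihat j w - pistar j)).
Qed.

Lemma measurable_support_event : measurable
  [set w | forall j, supp (pihat j w) = supp (pistar j)].
Proof.
rewrite (_ : [set w | _] = [set w | forall jk : 'I_p * 'I_d,
    [set w | (pihat jk.1 w jk.2 0 != 0) = (pistar jk.1 jk.2 0 != 0)] w]).
  apply: measurable_bigcap_countable => -[j k] /=.
  have m0 : measurable [set w | pihat j w k 0 = 0].
    rewrite (_ : [set w | _] = (fun w => pihat j w k 0) @^-1` [set 0])//.
    by rewrite -[_ @^-1` _]setTI; apply: mpi.
  case: (pistar j k 0 != 0).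
    rewrite [X in measurable X](_ : _ = ~` [set w | pihat j w k 0 = 0]); first exact: measurableC.
    by apply/seteqP; split => w /= /eqP.
  rewrite [X in measurable X](_ : _ = [set w | pihat j w k 0 = 0])//.
  by apply/seteqP; split => w /=; [move=> /negbFE/eqP | move=> ->; rewrite eqxx].
apply/seteqP; split => w /= H.
  by move=> [j k] /=; have /setP/(_ k) := H j; rewrite !inE.
by move=> j; apply/setP => k; rewrite !inE; exact: (H (j, k)).
Qed.

End first_stage_events.

Lemma l0normB_le (R : realType) (d : nat) (x y : 'cV[R]_d) :
  supp x = supp y -> (l0norm (x - y) <= l0norm y)%N.
Proof.
move=> xy; apply: subset_leq_card; apply/fintype.subsetP => l.
have : (l \in supp x) = (l \in supp y) by rewrite xy.
rewrite !inE !mxE => h; apply: contraNneq => y0.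
by move: h; rewrite y0 eqxx /= => /negbFE/eqP ->; rewrite subr0.
Qed.

Section regular_regime.
Context dd (T : measurableType dd) (R : realType) (P : probability T R)
  (n p d k : nat) (pistar : 'I_p -> 'cV[R]_d) (pihat : 'I_p -> T -> 'cV[R]_d)
  (Z : 'I_p -> T -> 'M[R]_(n, d)) (SigmaX : 'M[R]_p)
  (SigmaW : ('I_p -> 'cV[R]_d) -> 'M[R]_p) (sX sW lam rho C L delta : R).
Hypothesis n0 : (0 < n)%N.
Hypothesis d0 : (0 < d)%N.
Hypothesis k1 : (0 < k)%N.
Hypothesis M1 : (1 < maxn p d)%N.
Hypothesis LE : L = ln (maxn p d)%:R.
Hypothesis L0 : 0 < L.
Hypothesis subX : sub_gaussian_mx P (fun w => stage_mx (Z ^~ w) pistar) SigmaX (sX ^+ 2).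
Hypothesis sX0 : 0 < sX.
Hypothesis sW0 : 0 <= sW.
Hypothesis mZ : forall j i l, measurable_fun setT (fun w => Z j w i l).
Hypothesis subW : forall v : 'I_p -> 'cV[R]_d, (forall j, sparse_ball k%:R (v j)) ->
  sub_gaussian_mx P (fun w => stage_mx (Z ^~ w) v) (SigmaW v) (sW ^+ 2).
Hypothesis sparse_pi : forall j, (l0norm (pistar j) <= k)%N.
Hypothesis lam_quad : forall u, lam * dot u u <= quad_form SigmaX u.
Hypothesis rho01 : 0 < rho <= 1.
Hypothesis rho_lam : sX ^+ 2 * rho <= lam.
Hypothesis CE : C = 4 * 12 ^+ 2 * 32 * expR 4.
Hypothesis large : 2 <= n%:R * rho ^+ 2 / (C * L).

Let N : R := n%:R.
Let N0 : 0 < N. Proof. by rewrite ltr0n. Qed.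
Let e4 : 1 <= expR 4 :> R. Proof. by have := expR_ge1Dx (4 : R); lra. Qed.
Let C4 : 4 <= C.
Proof. rewrite CE; move: (expR 4) e4 => e h; lra. Qed.
Let C0 : 0 < C. Proof. by have := C4; lra. Qed.
Let rho0 : 0 < rho. Proof. by case/andP: rho01. Qed.
Let rho1 : rho <= 1. Proof. by case/andP: rho01. Qed.

Let m : nat := Num.trunc (N / (4 * L)).
Let m' : nat := Num.trunc (N * rho ^+ 2 / (C * L)).

Let m_spec : [/\ (1 < m)%N, 4 * m%:R * L <= N & m%:R^-1 <= 8 * (L / N)].
Proof.
have h : 2 <= N / (4 * L).
  have r2 : rho ^+ 2 <= 1 by rewrite exprn_ile1// ltW.
  have CL : 4 * L <= C * L by rewrite ler_pM2r.
  have L4 : 0 < 4 * L by rewrite mulr_gt0.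
  apply: (le_trans large); rewrite ler_pdivrMr ?(lt_le_trans L4)//.
  rewrite mulrAC ler_pdivlMr//; apply: ler_pM => //; rewrite ?(ltW L4)//.
    by rewrite mulr_ge0 ?sqr_ge0// ltW.
  by rewrite ler_piMr// ltW.
have [a b c] := trunc_half_le h; split => //.
  rewrite -/m ler_pdivlMr ?mulr_gt0// in b; apply: le_trans b; rewrite le_eqVlt; apply/orP; left.
  by apply/eqP; ring.
apply: le_trans c _; apply: le_of_eq.
by field; rewrite !gt_eqF.
Qed.

Let m'_spec : [/\ (1 < m')%N, 4 * m'%:R * L <= N * (rho / 12) ^+ 2 / (32 * expR 4)
  & m'%:R^-1 <= 2 * C * (L / (N * rho ^+ 2))].
Proof.
have [a b c] := trunc_half_le large; split => //.
  rewrite -/m' ler_pdivlMr ?mulr_gt0// in b.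
  have c12 : 0 < 12 ^+ 2 * 32 * expR 4 :> R by rewrite mulr_gt0 ?expR_gt0.
  rewrite -(ler_pM2l c12).
  rewrite [leRHS](_ : _ = N * rho ^+ 2); last by field; rewrite gt_eqF ?expR_gt0.
  apply: le_trans b; rewrite CE; apply: le_of_eq; ring.
apply: le_trans c _; apply: le_of_eq.
by field; rewrite !gt_eqF.
Qed.

Let count_exp_le (q l : nat) (e : R) : (1 < l)%N -> (q <= d * p * 2)%N -> 4 * l%:R * L <= e ->
  (q ^ l)%:R * expR (- e) <= expR (- L).
Proof.
move=> l1 qdp le_e.
apply: (@le_trans _ _ (expR (3 * l%:R * L) * expR (- e))).
  rewrite ler_pM2r ?expR_gt0// LE; apply: atom_count_le => //; exact: ltnW.
rewrite -expRD ler_expR; have : L <= l%:R * L by rewrite ler_peMl ?ler1n ?(ltW L0)// ltnW.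
lra.
Qed.

(** The three uniform estimates hold outside an event of probability
    4 exp(- L), one unit for each upper bound and two for the two-sided
    deviation behind the lower bound. The lower bound is used with x = rho / 12,
    for which its deviation 6 sX^2 x is at most lam / 2. *)
Lemma regular_regime_event : exists2 E, measurable E &
  ((1 - 4 * expR (- L))%:E <= P E)%E /\
  forall w, E w -> 0 <= delta -> (forall j, supp (pihat j w) = supp (pistar j)) ->
    (forall j, l2norm (pihat j w - pistar j) <= delta) ->
    forall v : 'cV[R]_p,
    lam / 2 * dot v v - 4 * C * (lam / rho ^+ 2) * (L / N) * l1norm v ^+ 2
     - 60 * (sX * sW * delta) * (dot v v + 16 * k%:R * (L / N) * l1norm v ^+ 2)
    <= dot (stage_mx (Z ^~ w) (pihat ^~ w) *m v) (stage_mx (Z ^~ w) (pihat ^~ w) *m v) / N.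
Proof.
have [m1 mL mI] := m_spec; have [m'1 m'L m'I] := m'_spec.
have linX w (c : R) (U V : 'cV[R]_p) : stage_mx (Z ^~ w) pistar *m (c *: U + V) =
  c *: (stage_mx (Z ^~ w) pistar *m U) + stage_mx (Z ^~ w) pistar *m V.
  by rewrite mulmxDr -scalemxAr.
have K0 s : 0 <= 30 * s ^+ 2 * N by rewrite mulr_ge0 ?(ltW N0)// mulr_ge0 ?sqr_ge0.
have [E1 mE1 [PE1 HE1]] := uniform_upper_bound (adm := xpredT) linX (fun _ _ _ _ => isT)
  (measurable_dot_row subX) (fun U _ => column_tail subX n0 U (erefl _) (ltW sX0))
  (expR_ge0 _) (K0 sX) m1.
have [E2 mE2 [PE2 HE2]] := uniform_upper_bound (adm := col_sparse k)
  (fun w => stage_apply_linear (Z ^~ w)) (@col_sparseS _ _ _ k)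
  (measurable_stage_apply mZ) (stage_apply_tail n0 sW0 subW)
  (expR_ge0 _) (K0 sW) m1.
have x01 : 0 < rho / 12 <= 1.
  by have := rho0; have := rho1 => h1 h2; apply/andP; split; lra.
have [E3 mE3 [PE3 HE3]] := uniform_lower_bound subX (covariance_matrix_sym subX n0) sX0 x01 m'1.
exists (E1 `&` (E2 `&` E3)); first by do 2 apply: measurableI => //.
split.
  have := probability_setI_ge mE1 (measurableI _ _ mE2 mE3) PE1 (probability_setI_ge mE2 mE3 PE2 PE3).
  apply: le_trans; rewrite lee_fin lerD2l lerN2.
  have q1 : (p * 1 * 2 <= d * p * 2)%N by rewrite muln1 leq_mul// leq_pmull.
  have q3 : (p * 2 <= d * p * 2)%N by rewrite leq_mul// leq_pmull.
  have h1 := count_exp_le m1 q1 mL.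
  have h2 := count_exp_le m1 (leqnn _) mL.
  have h3 := count_exp_le m'1 q3 m'L.
  rewrite (mulrCA _ 2); lra.
move=> w [E1w [E2w E3w]] de0 supE errE v.
pose D j := pihat j w - pistar j.
have Dk j : (l0norm (D j) <= k)%N := leq_trans (l0normB_le (supE j)) (sparse_pi j).
pose U := scaled_columns D v.
have hatE : stage_mx (Z ^~ w) (pihat ^~ w) *m v =
    stage_mx (Z ^~ w) pistar *m v + stage_apply (Z ^~ w) U.
  rewrite !stage_mx_mul -[X in X + _]scale1r -stage_apply_linear scale1r.
  by congr stage_apply; apply/matrixP => l j; rewrite !mxE; ring.
have Usp : col_sparse k U.
  by apply/forallP => j; rewrite col_scaled_columns; apply: leq_trans (Dk j); exact: l0normZ_le.
set v2 := dot v v; set v1 := l1norm v ^+ 2.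
have v20 : 0 <= v2 by exact: dot_ge0.
have v10 : 0 <= v1 by exact: sqr_ge0.
pose Q := v2 + 16 * k%:R * (L / N) * v1.
have LN0 : 0 <= L / N by rewrite divr_ge0 ?ltW.
have k1R : 1 <= k%:R :> R by rewrite ler1n.
have Q0 : 0 <= Q by rewrite addr_ge0// mulr_ge0// mulr_ge0// mulr_ge0.
have twom : 2 / m%:R <= 16 * (L / N) by move: mI; move: (m%:R^-1 : R) (L / N) => x y; lra.
have upX : dot (stage_mx (Z ^~ w) pistar *m v) (stage_mx (Z ^~ w) pistar *m v)
    <= 30 * sX ^+ 2 * N * Q.
  apply: le_trans (HE1 w E1w v isT) _; apply: ler_wpM2l => //.
  rewrite mdot_col l1mx_col lerD2l -/v1; apply: ler_wpM2r => //.
  by apply: le_trans twom _; rewrite ler_wpM2r// ler_peMr.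
have upW : dot (stage_apply (Z ^~ w) U) (stage_apply (Z ^~ w) U)
    <= 30 * (sW * delta) ^+ 2 * N * Q.
  apply: le_trans (HE2 w E2w U Usp) _.
  have -> : 30 * (sW * delta) ^+ 2 * N * Q = 30 * sW ^+ 2 * N * (delta ^+ 2 * Q) by ring.
  apply: ler_wpM2l => //; rewrite /Q mulrDr; apply: lerD.
    exact: mdot_scaled_columns_le.
  apply: le_trans (ler_wpM2l _ (l1mx_scaled_columns_le v Dk errE de0)) _.
    by rewrite mulr_ge0// invr_ge0.
  have -> : delta ^+ 2 * (16 * k%:R * (L / N) * v1) = (16 * (L / N)) * (k%:R * delta ^+ 2 * v1) by ring.
  by apply: ler_wpM2r => //; rewrite mulr_ge0// mulr_ge0 ?sqr_ge0.
have lowX : N * (lam / 2 * v2 - 4 * C * (lam / rho ^+ 2) * (L / N) * v1)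
    <= dot (stage_mx (Z ^~ w) pistar *m v) (stage_mx (Z ^~ w) pistar *m v).
  apply: le_trans (HE3 w E3w v); rewrite ler_pM2l// -/v2 -/v1.
  have D2 : 6 * sX ^+ 2 * (rho / 12) <= lam / 2.
    rewrite (_ : 6 * sX ^+ 2 * (rho / 12) = (sX ^+ 2 * rho) / 2); last by field.
    by rewrite ler_pM2r.
  have h1 := lam_quad v; rewrite -/v2 in h1.
  have h2 : 6 * sX ^+ 2 * (rho / 12) * v2 <= lam / 2 * v2.
    exact: ler_wpM2r.
  have h3 : 6 * sX ^+ 2 * (rho / 12) * (4 / m'%:R * v1) <= 4 * C * (lam / rho ^+ 2) * (L / N) * v1.
    rewrite [leLHS]mulrA; apply: ler_wpM2r => //.
    apply: (@le_trans _ _ (lam / 2 * (4 * (2 * C * (L / (N * rho ^+ 2)))))).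
      apply: ler_pM; [|by rewrite divr_ge0|exact: D2|by rewrite ler_wpM2l].
      by rewrite mulr_ge0 ?divr_ge0 ?(ltW rho0)// mulr_ge0 ?sqr_ge0.
    apply: le_of_eq; field; rewrite !gt_eqF//.
  rewrite mulrDr; lra.
rewrite hatE ler_pdivlMr//.
(* both squares are multiples of the same Q, hence so is the cross term *)
pose sq := Num.sqrt (30 * N * Q).
have sq2 : sq ^+ 2 = 30 * N * Q by rewrite sqr_sqrtr// !mulr_ge0// ltW.
have sq0 : 0 <= sq := sqrtr_ge0 _.
have upX' : dot (stage_mx (Z ^~ w) pistar *m v) (stage_mx (Z ^~ w) pistar *m v) <= (sX * sq) ^+ 2.
  by apply: le_trans upX _; rewrite [leRHS]exprMn sq2; apply: le_of_eq; ring.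
have upW' : dot (stage_apply (Z ^~ w) U) (stage_apply (Z ^~ w) U) <= (sW * delta * sq) ^+ 2.
  by apply: le_trans upW _; rewrite [leRHS]exprMn sq2; apply: le_of_eq; ring.
have cX : 0 <= sX * sq by rewrite mulr_ge0// ltW.
have cW : 0 <= sW * delta * sq by rewrite !mulr_ge0.
have := dot_perturbation_ge cX cW lowX upX' upW'.
apply: le_trans; apply: le_of_eq.
have -> : 2 * (sX * sq) * (sW * delta * sq) = 2 * sX * sW * delta * sq ^+ 2 by ring.
by rewrite sq2 /Q; ring.
Qed.

End regular_regime.

(** * The vacuous regime and measurability of the conclusion *)

Section degenerate_regimes.
Context (R : realType).

Lemma dot_le_l1norm_sqr (p : nat) (v : 'cV[R]_p) : dot v v <= l1norm v ^+ 2.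
Proof.
rewrite dotvv expr2 /l1norm mulr_suml; apply: ler_sum => i _.
rewrite -real_normK ?num_real// expr2 ler_wpM2l//.
by rewrite (bigD1 i)//= lerDl sumr_ge0.
Qed.

(** Division by zero yields zero, so the sparsity level would vanish for L = 0. *)
Lemma sparsity_level_pos (c0 N y L t : R) : 0 < c0 -> 0 <= N -> 0 <= y -> 0 <= L ->
  1 <= c0^-1 * (N / (y * L)) * t -> 0 < t /\ 0 < L.
Proof.
move=> c00 N0 y0 L0 H; split.
  rewrite ltNge; apply/negP => t0.
  have A : 0 <= c0^-1 * (N / (y * L)) by rewrite mulr_ge0 ?invr_ge0 ?(ltW c00)// divr_ge0 ?mulr_ge0.
  have := mulr_ge0_le0 A t0; lra.
rewrite lt_def L0 andbT; apply: contraTneq H => ->.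
by rewrite mulr0 invr0 mulr0 mulr0 mul0r -ltNge ltr01.
Qed.

(** In this regime L / N >= rho^2 / (2 C), so the l1 term is at least a multiple
    of b0 rho^2 |v|_1^2 = lam |v|_1^2 >= lam |v|_2^2. *)
Lemma vacuous_lower_bound (N rho L C b0 lam y c' k3 g v2 v1 : R) :
  0 < N -> 0 < rho -> 0 < L -> 0 < C -> 0 < b0 -> b0 * rho ^+ 2 = lam ->
  N * rho ^+ 2 / (C * L) < 2 -> 1 <= y -> 4 * C <= c' -> b0 <= k3 -> 0 <= g ->
  0 <= v2 -> v2 <= v1 ->
  (lam / 2 - g) * v2 - c' * k3 * (y * L / N) * v1 <= 0.
Proof.
move=> N0 rho0 L0 C0 b00 <- small y1 cC bk g0 v20 v21.
rewrite ltr_pdivrMr ?mulr_gt0// in small.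
have LN : rho ^+ 2 <= 2 * C * (L / N).
  by rewrite mulrA ler_pdivlMr// mulrC -mulrA; exact: ltW.
have LN0 : 0 < L / N by rewrite divr_gt0.
have A : b0 * rho ^+ 2 / 2 * v2 <= c' * k3 * (y * L / N) * v1.
  apply: ler_pM => //; first by rewrite divr_ge0// mulr_ge0 ?sqr_ge0// ltW.
  apply: (@le_trans _ _ (4 * C * b0 * (L / N))).
    have := ler_wpM2l (ltW b00) LN; have : 0 <= C * b0 * (L / N) by rewrite mulr_ge0 ?(ltW LN0)// mulr_ge0// ltW.
    by move=> h1 h2; lra.
  apply: ler_pM; rewrite ?(ltW LN0)//.
  - by rewrite !mulr_ge0// ltW.
  - by apply: ler_pM => //; rewrite ?mulr_ge0// ltW.
  - by rewrite -mulrA ler_peMl// ltW.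
have : 0 <= g * v2 by rewrite mulr_ge0.
by rewrite mulrBl; lra.
Qed.

End degenerate_regimes.

Section conclusion_event.
Context dd (T : measurableType dd) (R : realType) (P : probability T R).

Lemma measurable_quadratic_event (n p : nat) (M : T -> 'M[R]_(n, p)) (a b c : R) :
  (forall i j, measurable_fun setT (fun w => M w i j)) ->
  measurable [set w | forall v : 'cV[R]_p,
    a * l2norm v ^+ 2 - b * l1norm v ^+ 2 <= l2norm (M w *m v) ^+ 2 / c].
Proof.
move=> mM.
pose S (q : 'cV[rat]_p) := let v := map_mx ratr q : 'cV[R]_p in
  [set w | a * dot v v - b * l1norm v ^+ 2 <= dot (M w *m v) (M w *m v) / c].
rewrite (_ : [set w | _] = [set w | forall q, S q w]).
  apply: measurable_bigcap_countable => q; apply: measurable_ge.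
  apply: measurable_funM => //; apply: measurable_dot => i.
  rewrite (_ : (fun w => _) = (fun w => \sum_j M w i j * map_mx ratr q j 0)); last first.
    by apply/funext => w; rewrite mxE.
  by apply: measurable_sum => j; exact: measurable_funM.
apply/seteqP; split => w /= H.
  by move=> q; rewrite /S /= -!l2norm_sqr; exact: H.
by move=> v; rewrite !l2norm_sqr; exact: forall_rational_quadratic.
Qed.

Lemma quad_form_zero_design (n p d : nat) (Z : 'I_p -> T -> 'M[R]_(n, d))
    (pistar : 'I_p -> 'cV[R]_d) (Sigma : 'M[R]_p) (s2 : R) u :
  (0 < n)%N -> (forall j, (l0norm (pistar j) <= 0)%N) ->
  sub_gaussian_mx P (fun w => stage_mx (Z ^~ w) pistar) Sigma s2 ->
  quad_form Sigma u = 0.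
Proof.
move=> n0 pi0 sub; apply: EFin_inj; rewrite -(row_second_moment sub u (Ordinal n0)).
apply: integral0_eq => w _; rewrite mxE big1 ?expr0n// => j _.
rewrite !mxE big1 ?mul0r// => l _.
have := pi0 j; rewrite leqn0 cards_eq0 => /eqP/setP/(_ l); rewrite !inE => /negbFE/eqP ->.
by rewrite mulr0.
Qed.

Lemma measurable_stage_mx (n p d : nat) (Z : 'I_p -> T -> 'M[R]_(n, d))
    (v : 'I_p -> T -> 'cV[R]_d) :
  (forall j i l, measurable_fun setT (fun w => Z j w i l)) ->
  (forall j l, measurable_fun setT (fun w => v j w l 0)) ->
  forall i j, measurable_fun setT (fun w => stage_mx (Z ^~ w) (v ^~ w) i j).
Proof.
move=> mZ mv i j.
rewrite (_ : (fun w => _) = (fun w => \sum_l Z j w i l * v j w l 0)); last first.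
  by apply/funext => w; rewrite !mxE.
by apply: measurable_sum => l; exact: measurable_funM.
Qed.

End conclusion_event.

(** * The restricted eigenvalue bound *)

Theorem lemma6p3 (R : realType)
  (* universal constants of the hypotheses: c0 in s(r), a in (viii), and those
     of (vi) and (vii) *)
  (c0 a cA c1A c2A c1B c2B : R)
  (hc0 : 0 < c0) (ha : 0 < a)
  (hcA : 0 < cA) (hc1A : 0 < c1A) (hc2A : 0 < c2A)
  (hc1B : 0 < c1B) (hc2B : 0 < c2B) :
  exists c c' c1 c2 : R, [/\ 0 < c, 0 < c', 0 < c1 & 0 < c2] /\
  forall (disp : measure_display) (T : measurableType disp)
    (P : probability T R)
    (n p d : nat) (hn : (0 < n)%N) (k1 k2 : nat -> nat) (r : R)
    (beta : 'cV[R]_p) (pistar : 'I_p -> 'cV[R]_d)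
    (y : T -> 'cV[R]_n) (X : T -> 'M[R]_(n, p))
    (Z : 'I_p -> T -> 'M[R]_(n, d))
    (eps : T -> 'cV[R]_n) (eta : 'I_p -> T -> 'cV[R]_n)
    (pihat : 'I_p -> T -> 'cV[R]_d)
    (sigma_eps sigma_eta sigma_Z sigma_X sigma_W : R)
    (SigmaZ : 'I_p -> 'M[R]_d) (SigmaX : 'M[R]_p)
    (SigmaW : ('I_p -> 'cV[R]_d) -> 'M[R]_p),
  let Xstar := fun w : T => stage_mx (Z ^~ w) pistar in
  let Xhat := fun w : T => stage_mx (Z ^~ w) (pihat ^~ w) in
  let N : R := n%:R in
  let K1 : R := (k1 n)%:R in
  let L : R := ln (maxn p d)%:R in
  let L3 : R := ln (maxn (maxn d p) n)%:R in
  let lamX := lambda_min SigmaX in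
  let lamZ := inf (range (fun j => lambda_min (SigmaZ j))) in
  let s : R := c0^-1 * (N / (K1 `^ r * L)) *
           Num.min (lamX ^+ 2 / sigma_X ^+ 4) 1 in
  let i1 := Ordinal hn in
  let b0 : R := lamX * Num.max (sigma_X ^+ 4 / lamX ^+ 2) 1 in
  let b1 : R := lamZ / sigma_eta in
  let b2 : R := Num.max (sigma_X * sigma_W) (sup_b2 P Z pistar (k1 n) s i1) in
  let b3 : R := Num.max (sigma_W ^+ 2) (sup_b3 P Z (k1 n) s i1) in
  let kappa1 : R := lamX / 2 in
  let kappa2 : R := Num.max (b2 * b1^-1) (b3 * b1 ^- 2) in
  let kappa3 : R := Num.max b0 (Num.max (b2 * b1^-1) (b3 * b1 ^- 2)) in
  forall
    (hr : 0 <= r <= 1)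
    (h_sigma : [/\ 0 <= sigma_eps, 0 <= sigma_eta, 0 <= sigma_Z,
                   0 <= sigma_X & 0 <= sigma_W])
    (h_s : 1 <= s)
    (* the triangular model *)
    (h_y : forall w, y w = X w *m beta + eps w)
    (h_x : forall w i j, X w i j = Xstar w i j + eta j w i 0)
    (h_pihat : forall j k, measurable_fun [set: T] (fun w => pihat j w k 0))
    (h_mean : forall i, [/\ zero_mean P (fun w => y w i 0),
       forall j, zero_mean P (fun w => X w i j) &
       forall j k, zero_mean P (fun w => Z j w i k)])
    (* (i) *)
    (h_iid : iid P (fun i w => data_row (y w) (X w) (Z ^~ w) i))
    (h_moments : forall i, [/\ (fun w => y w i 0) \in Lfun P 2%:E,
       forall j, (fun w => X w i j) \in Lfun P 2%:E &
       forall j k, (fun w => Z j w i k) \in Lfun P 2%:E])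
    (h_z_eps : forall i j k,
       ('E_P[fun w => (Z j w i k * eps w i 0)%R] = 0)%E)
    (h_z_eta : forall i j k,
       ('E_P[fun w => (Z j w i k * eta j w i 0)%R] = 0)%E)
    (h_z_eta' : forall i j j' k, j != j' ->
       ('E_P[fun w => (Z j w i k * eta j' w i 0)%R] = 0)%E)
    (* (ii) *)
    (h_p : (n <= p)%N) (h_d : (n <= d)%N)
    (h_pi : forall j, (l0norm (pistar j) <= k1 n)%N)
    (h_beta : (l0norm beta <= k2 n)%N)
    (h_k1 : (fun m : nat => (k1 m)%:R / m%:R : R) @ \oo --> (0 : R))
    (h_k2 : (fun m : nat => (k2 m)%:R / m%:R : R) @ \oo --> (0 : R))
    (* (iii) *)
    (h_eps : sub_gaussian_vec P eps (sigma_eps ^+ 2))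
    (h_eta : forall j, sub_gaussian_vec P (eta j) (sigma_eta ^+ 2))
    (h_Z : forall j, sub_gaussian_mx P (Z j) (SigmaZ j) (sigma_Z ^+ 2))
    (* (iv) *)
    (h_X : sub_gaussian_mx P Xstar SigmaX (sigma_X ^+ 2))
    (* (v) *)
    (h_W : forall v : 'I_p -> 'cV[R]_d, (forall j, sparse_ball K1 (v j)) ->
       sub_gaussian_mx P (fun w => stage_mx (Z ^~ w) v) (SigmaW v)
         (sigma_W ^+ 2))
    (* (vi) *)
    (h_first : ((1 - c1A * expR (- c2A * L3))%R%:E <=
       P [set w | (\big[Num.max/0]_(j < p) l2norm (pihat j w - pistar j) <=
                   cA * sigma_eta / lamZ * Num.sqrt (K1 * L / N))%R])%E)
    (* (vii) *)
    (h_supp : ((1 - c1B * expR (- c2B * L3))%R%:E <=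
       P [set w | forall j, supp (pihat j w) = supp (pistar j)])%E)
    (* (viii) *)
    (h_n : a * (K1 `^ (3 - 2 * r) * L) <= N),
  ((1 - c1 * expR (- c2 * L))%R%:E <=
   P [set w | forall v0 : 'cV[R]_p,
      ((kappa1 - c * kappa2 * K1 `^ (3 / 2 - r) * Num.sqrt (L / N)) *
         l2norm v0 ^+ 2
       - c' * kappa3 * (K1 `^ r * L / N) * l1norm v0 ^+ 2
       <= l2norm (Xhat w *m v0) ^+ 2 / N)%R])%E.
Proof.
pose C : R := 4 * 12 ^+ 2 * 32 * expR 4.
have C0 : 0 < C by rewrite mulr_gt0 ?expR_gt0// mulr_gt0// mulr_gt0.
have sa0 : 0 < Num.sqrt a by rewrite sqrtr_gt0.
have D0 : 0 < 960 * cA / Num.sqrt a.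
  have p960 : (0 : R) < 960 by rewrite ltr0n.
  exact: divr_gt0 (mulr_gt0 p960 hcA) sa0.
have C40 : 0 < 4 * C by rewrite mulr_gt0.
exists (60 * cA), (4 * C + 960 * cA / Num.sqrt a), (c1A + c1B + 4), (Num.min (Num.min c2A c2B) 1).
split.
  split; first by rewrite mulr_gt0.
  - exact: addr_gt0.
  - by rewrite !addr_gt0.
  - by rewrite !lt_min hc2A hc2B ltr01.
move=> disp T P n p d hn k1 k2 r beta pistar y X Z eps eta pihat.
move=> sigma_eps sigma_eta sigma_Z sigma_X sigma_W SigmaZ SigmaX SigmaW.
move=> Xstar Xhat N K1 L L3 lamX lamZ s i1 b0 b1 b2 b3 kappa1 kappa2 kappa3.
move=> /andP[r0 r1] [_ _ _ sX0 sW0] h_s _ _ mpi.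
move=> _ _ _ _ _ _ h_p h_d h_pi _ _ _ _ _ h_Z h_X h_W h_first h_supp h_n.
have N0 : 0 < N by rewrite ltr0n.
have p0 : (0 < p)%N := leq_trans hn h_p.
have d0 : (0 < d)%N := leq_trans hn h_d.
have M0 : (0 < maxn p d)%N by rewrite leq_max p0.
have L0' : 0 <= L by rewrite ln_ge0// ler1n.
have K10 : 0 <= K1 by rewrite ler0n.
have [min0 L0] := sparsity_level_pos hc0 (ltW N0) (powR_ge0 K1 r) L0' h_s.
have lamX_neq0 : lamX != 0.
  by apply: contraTneq min0 => ->; rewrite expr0n /= mul0r lt_min ltxx.
have sX : 0 < sigma_X.
  rewrite lt_def sX0 andbT; apply: contraTneq min0 => ->.
  by rewrite expr0n /= invr0 mulr0 lt_min ltxx.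
have symX := covariance_matrix_sym h_X hn.
have psdX := covariance_matrix_psd h_X hn.
have [lam0' lamq] := lambda_min_quad symX psdX.
have lam0 : 0 < lamX by rewrite lt_def lamX_neq0.
(* if k1 n = 0 the design vanishes, and so does its smallest eigenvalue *)
have k1_gt0 : (0 < k1 n)%N.
  rewrite lt0n; apply/negP => /eqP k10.
  have pi0 j : (l0norm (pistar j) <= 0)%N by rewrite -k10.
  pose u : 'cV[R]_p := delta_mx (Ordinal p0) 0.
  have := lamq u; rewrite (quad_form_zero_design u hn pi0 h_X).
  by rewrite -mdot_col mdot_delta mulr1 leNgt lam0.
have K1ge1 : 1 <= K1 by rewrite ler1n.
have M1 : (1 < maxn p d)%N.
  rewrite ltnNge; apply: contraTN L0 => M1; rewrite -leNgt.
  by rewrite ln_le0// lern1.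
have Kr1 : 1 <= K1 `^ r by rewrite -[leLHS](powRr0 K1) ler_powR.
pose rho := Num.min (lamX / sigma_X ^+ 2) 1.
have rho0 : 0 < rho by rewrite lt_min ltr01 divr_gt0 ?exprn_gt0.
have rho1 : rho <= 1 by rewrite ge_min lexx orbT.
have rholam : sigma_X ^+ 2 * rho <= lamX.
  by rewrite mulrC -ler_pdivlMr ?exprn_gt0// ge_min lexx.
have b0rho : b0 * rho ^+ 2 = lamX by rewrite /b0 -mulrA max_min_ratio// mulr1.
have b00 : 0 < b0 by rewrite -(pmulr_lgt0 _ (exprn_gt0 2 rho0)) b0rho.
have sXW0 : 0 <= sigma_X * sigma_W by rewrite mulr_ge0.
have b2ge : sigma_X * sigma_W <= b2 by rewrite le_max lexx.
have b3ge : 0 <= b3 by rewrite le_max sqr_ge0.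
have kappa2_ge0 : 0 <= kappa2.
  by rewrite le_max; apply/orP; right; rewrite mulr_ge0// -exprVn sqr_ge0.
have kappa3_b0 : b0 <= kappa3 by rewrite le_max lexx.
have LN0 : 0 < L / N by rewrite divr_gt0.
have mZ j i l : measurable_fun setT (fun w => Z j w i l).
  exact: measurable_sub_gaussian_entry (h_Z j) i l.
have mG := @measurable_quadratic_event _ _ R _ _ _
  (kappa1 - 60 * cA * kappa2 * K1 `^ (3 / 2 - r) * Num.sqrt (L / N))
  ((4 * C + 960 * cA / Num.sqrt a) * kappa3 * (K1 `^ r * L / N)) N
  (measurable_stage_mx mZ mpi).
(* below the threshold 2 the lower bound cannot be sampled with m >= 2 atoms *)
have [small|large] := ltP (N * rho ^+ 2 / (C * L)) 2.
  set G := [set w | _]; have -> : G = setT.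
    apply/seteqP; split => // w _ v0; apply: (@le_trans _ _ 0); last first.
      by rewrite divr_ge0 ?sqr_ge0// ltW.
    rewrite l2norm_sqr.
    apply: (vacuous_lower_bound N0 rho0 L0 C0 b00 b0rho small Kr1) => //.
    - by rewrite lerDl ltW.
    - by rewrite !mulr_ge0 ?powR_ge0 ?sqrtr_ge0 ?(ltW hcA).
    - exact: dot_ge0.
    - exact: dot_le_l1norm_sqr.
  rewrite probability_setT lee_fin gerBl mulr_ge0 ?expR_ge0//.
  by rewrite !addr_ge0 ?(ltW hc1A) ?(ltW hc1B).
have rho01 : 0 < rho <= 1 by rewrite rho0.
pose beta1 := sigma_eta / lamZ.
pose delta := cA * sigma_eta / lamZ * Num.sqrt (K1 * L / N).
have [E mE [PE HE]] := regular_regime_event pihat delta hn d0 k1_gt0 M1 (erefl L) L0 h_X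
  sX sW0 mZ h_W h_pi
  lamq rho01 rholam (erefl C) large.
have mE1 := measurable_error_event pistar mpi delta.
have mE2 := measurable_support_event pistar mpi.
have mE12 := measurableI _ _ mE1 mE2.
have PE12 := probability_setI_ge mE1 mE2 h_first h_supp.
have PE123 := probability_setI_ge mE12 mE PE12 PE.
apply: (@le_trans _ _ (1 - (c1A * expR (- c2A * L3) + c1B * expR (- c2B * L3) + 4 * expR (- L)))%:E).
  rewrite lee_fin lerD2l lerN2.
  have nM : (n <= maxn p d)%N by rewrite leq_max h_p.
  have L3E : L3 = L by rewrite /L3 (maxnC d p) (maxn_idPl nM).
  rewrite L3E (mulrDl (c1A + c1B) 4) (mulrDl c1A); apply: lerD; first apply: lerD.
  - rewrite ler_pM2l// ler_expR !mulNr lerN2 ler_wpM2r//.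
    by rewrite !ge_min lexx.
  - rewrite ler_pM2l// ler_expR !mulNr lerN2 ler_wpM2r//.
    by rewrite !ge_min lexx orbT.
  - by rewrite ler_pM2l// ler_expR mulNr lerN2 ler_piMl// ge_min lexx orbT.
apply: (le_trans PE123); apply: le_probability => //; first exact: measurableI.
move=> w [[/= E1w E2w] Ew] v0.
have [de0 errE] := (bigmax_l2norm_le (fun j => pihat j w - pistar j) delta).1 E1w.
have {}errE j : l2norm (pihat j w - pistar j) <= delta.
  have := errE j.
  by rewrite -l2norm_sqr ler_pXn2r ?nnegrE ?l2norm_ge0.
have := HE w Ew de0 E2w errE v0.
rewrite !l2norm_sqr => H; apply: le_trans H.
have sq0 : 0 < Num.sqrt (K1 * L / N) by rewrite sqrtr_gt0 divr_gt0// mulr_gt0// (lt_le_trans ltr01).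
have deltaE : delta = cA * Num.sqrt (K1 * L / N) * beta1.
  by rewrite /delta /beta1 [LHS]mulrAC (mulrAC cA) -mulrA.
(* on this event 0 <= delta, which settles the sign of sigma_eta / lamZ *)
have beta0 : 0 <= beta1.
  by move: de0; rewrite deltaE pmulr_rge0// mulr_gt0.
have b1E : b1^-1 = beta1 by rewrite /b1 invf_div.
have g0 : 0 <= sigma_X * sigma_W * beta1 by rewrite mulr_ge0.
have gb : sigma_X * sigma_W * beta1 <= b2 * b1^-1.
  by rewrite b1E; apply: ler_wpM2r.
have gk2 : sigma_X * sigma_W * beta1 <= kappa2 by rewrite le_max gb.
have gk3 : sigma_X * sigma_W * beta1 <= kappa3 by rewrite !le_max gb orbT.
have := @rate_bound R a K1 r L N cA (4 * C) b0 kappa2 kappa3 (lamX / 2) (sigma_X * sigma_W * beta1)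
  (dot v0 v0) (l1norm v0 ^+ 2) K1ge1 r1 ha N0 L0 hcA _ (ltW b00) g0 gk2 gk3 kappa3_b0
  (dot_ge0 v0) (sqr_ge0 _) h_n r0.
have b0E : lamX / rho ^+ 2 = b0 by rewrite -b0rho mulfK// expf_neq0// gt_eqF.
have dE : sigma_X * sigma_W * delta = sigma_X * sigma_W * beta1 * (cA * Num.sqrt (K1 * L / N)).
  by rewrite deltaE mulrA mulrAC.
rewrite b0E dE; apply; exact: ltW.
Qed.
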